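(* Consider the delayed projected stochastic gradient iteration $x(t+1)=\Pi_{\mathcal S}[x(t)-\eta(t)g(t)]$ described in the context, and suppose that the Assumptions on Objective Functions, on Gradient Estimators (with bias sequence $\{q(t)\}$), and on Communication Delay (with constants $C$ and $\kappa$) stated in the context hold. Let $f$ be convex, and assume in addition that there exists $R\in(0,\infty)$ such that $\mathbb E[\|x(t)-x^*\|^2]\le R$ for $x^*\in\operatorname{argmin}_{x\in\mathcal S}f(x)$ and all $t$. Let the (positive) step size sequence $\{\eta(t)\}_{t\ge0}$ be decreasing with $\lim_{t\to\infty}\frac{\eta(\lceil\kappa t\rceil)}{\eta(t)}=\bar\eta$ for some constant $\bar\eta>0$ and $\sum_{t=0}^\infty\eta(t)=\infty$. Let $\tilde x(T)=\sum_{t=0}^T\frac{\eta(t)}{\sum_{s=0}^T\eta(s)}x(t)$. Then, as $T\to\infty$, $$\mathbb E[f(\tilde x(T))]-f^*=\mathcal O\left(\frac{\sum_{t=0}^T\left(\eta^2(t)+\eta(t)q(t)\right)}{\sum_{t=0}^T\eta(t)}\right).$$ In particular, if $\eta(t)=\frac{\eta_0}{\sqrt{t+1}}$ for some constant $\eta_0>0$ and $q(t)=\frac{q_0}{(t+1)^\beta}$ for some constant $q_0>0$ and $\beta\ge\frac12$, then $\mathbb E[f(\tilde x(T))]-f^*=\mathcal O\left(\frac{\log T}{\sqrt T}\right)=\mathcal O\left(\frac{1}{T^{\frac12-\varepsilon}}\right)$ for any $0<\varepsilon<\frac12$.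
   Context: Setting. Let $\mathcal S\subset\mathbb R^d$ be a closed convex set, $n\ge 1$, $f_i:\mathcal S\to\mathbb R$ for $i\in[n]=\{1,\dots,n\}$, and $f=\sum_{i=1}^n f_i$; the goal is to minimize $f$ over $\mathcal S$. $\|\cdot\|$ is the Euclidean norm and $\Pi_{\mathcal S}:\mathbb R^d\to\mathcal S$ is the Euclidean projection onto $\mathcal S$. A server maintains $x(t)\in\mathcal S$, $t\in\{0,1,2,\dots\}$, with $x(0)=x_0\in\mathcal S$ arbitrary. At each time $t$ it sends $x(t)$ to all agents. Agent $i$ can return a stochastic gradient estimate $g_i(x(t),\xi(t))\in\mathbb R^d$, depending on $x(t)$ and a random variable $\xi(t)$ independent of $x(t)$. Let $\tau_i(t)\le t$ be the (random) time stamp of the latest gradient information from agent $i$ available to the server at time $t$, i.e. this information is $g_i(x(\tau_i(t)),\xi(\tau_i(t)))$; if nothing has been received from agent $i$, then $\tau_i(t)=-1$ and this term is $0$. The server forms $g(t)=\sum_{i=1}^n g_i(x(\tau_i(t)),\xi(\tau_i(t)))$ and updates $x(t+1)=\Pi_{\mathcal S}[x(t)-\eta(t)g(t)]$ with step sizes $\eta(t)>0$. Assumption on Objective Functions. $f^*:=\inf_{x\in\mathcal S}f(x)>-\infty$, $f$ is continuously differentiable, and each $f_i$ is $L$-smooth: $\|\nabla f_i(x)-\nabla f_i(y)\|\le L\|x-y\|$ for all $x,y\in\mathcal S$. Assumption on Gradient Estimators. Let $\tilde g_i(t):=\mathbb E[g_i(x(t),\xi(t))\mid\sigma(x(t))]$,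 where $\sigma(x(t))$ is the $\sigma$-algebra generated by $x(t)$. There is $G\in(0,\infty)$ such that for all $t$ and all $i\in[n]$, $\mathbb E[\|g_i(x(t),\xi(t))\|^2\mid\sigma(x(t))]\le G$. For all $t_1,t_2\in\{0,1,2,\dots\}$, $\|\tilde g_i(t_1)-\tilde g_i(t_2)\|\le L\|x(t_1)-x(t_2)\|$. Finally $\|\tilde g_i(t)-\nabla f_i(x(t))\|\le q(t)$ for a non-negative (deterministic) sequence $\{q(t)\}_{t\ge0}$, called the gradient estimator bias. Assumption on Communication Delay. The delays $t-\tau_i(t)$ are independent across time and agents. There is $0<C<\infty$ such that $\mathbb E[(t-\tau_i(t))^2]\le C$ for all $t\in\{0,1,2,\dots\}$ and $i\in[n]$. There is $\kappa\in(0,1)$ such that $t-\tau_i(t)\le(1-\kappa)t$, i.e. $\tau_i(t)\ge\kappa t$, for all $t$ and $i$.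
   Formalization: The formal theorem additionally assumes that the family of all delays is independent of the family of all gradient noises ξ(t); without this, delays that select noisy estimates can bias g(t) and the claimed rate fails. *)

(* Defs.v *)
From HB Require Import structures.
From mathcomp Require Import all_boot all_order all_algebra.
From mathcomp Require Import finmap.
From mathcomp Require Import all_classical all_reals all_analysis.

Set Implicit Arguments.
Unset Strict Implicit.
Unset Printing Implicit Defensive.

Import Order.TTheory GRing.Theory Num.Theory.
Import numFieldNormedType.Exports.

Local Open Scope classical_set_scope.
Local Open Scope ring_scope.

HB.instance Definition _ := isPointed.Build int 0.

HB.instance Definition _ := @isMeasurable.Build default_measure_display
  int discrete_measurable discrete_measurable0
  discrete_measurableC discrete_measurableU.

Section Euclidean.
Context {R : realType} {d : nat}.
Implicit Types (x y u v : 'rV[R]_d) (S : set 'rV[R]_d).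

Definition dotr u v : R := \sum_(j < d) u 0 j * v 0 j.

(* The norm `|_| of the library on 'rV[R]_d is the sup norm. It defines the
   same topology, so closed, open and nbhs below are the Euclidean notions. *)
Definition enorm u : R := Num.sqrt (dotr u u).

(* Unique when S is nonempty, closed and convex. *)
Definition eproj S y : 'rV[R]_d :=
  get [set z | S z /\ forall s, S s -> enorm (y - z) <= enorm (y - s)].

(* gf is a gradient of f on S, relative to S: only the values of f on S matter,
   and no neighbourhood of S is needed at boundary points. *)
Definition gradient_on S (f : 'rV[R]_d -> R) (gf : 'rV[R]_d -> 'rV[R]_d) :=
  forall x, S x -> forall eps : R, 0 < eps ->
    \forall y \near within S (nbhs x),
      `|f y - f x - dotr (gf x) (y - x)| <= eps * enorm (y - x).

Definition continuously_differentiable_on S (f : 'rV[R]_d -> R) :=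
  exists gf : 'rV[R]_d -> 'rV[R]_d,
    gradient_on S f gf /\ {within S, continuous gf}.

Definition argmin_on S (f : 'rV[R]_d -> R) : set 'rV[R]_d :=
  [set x | S x /\ forall y, S y -> f x <= f y].

End Euclidean.

(* The library puts no sigma-algebra on 'rV[R]_d; this is the Borel one. *)
Notation borel_rV R d := (g_sigma_algebraType [set A : set 'rV[R]_d | open A]).

Section Probability.
Context {R : realType} {disp : measure_display} {Omega : measurableType disp}.
Variable P : probability Omega R.

Definition indep (F G : set (set Omega)) : Prop :=
  forall A B, F A -> G B -> P (A `&` B) = (P A * P B)%E.

Definition mutually_indep (I : choiceType) (F : I -> set (set Omega)) : Prop :=
  forall (J : {fset I}) (A : I -> set Omega),
    (forall i, i \in J -> F i (A i)) ->
    P (\bigcap_(i in [set` J]) A i) = (\prod_(i <- J) P (A i))%E.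

Definition sigma_family (I : Type) (dispT : measure_display)
    (T : measurableType dispT) (X : I -> Omega -> T) : set (set Omega) :=
  <<s \bigcup_i g_sigma_algebra_preimage (X i) >>.

Definition cond_expectation (F : set (set Omega)) (X Y : Omega -> R) : Prop :=
  [/\ P.-integrable setT (EFin \o X),
      P.-integrable setT (EFin \o Y),
      forall B : set R, measurable B -> F (Y @^-1` B) &
      forall A, F A ->
        (\int[P]_(w in A) (Y w)%:E = \int[P]_(w in A) (X w)%:E)%E].

Definition cond_expectation_rV (d : nat) (F : set (set Omega))
    (X Y : Omega -> 'rV[R]_d) : Prop :=
  forall j, cond_expectation F (fun w => X w 0 j) (fun w => Y w 0 j).

End Probability.

Section Algorithm.
Context {R : realType} {d n : nat}.
Context {disp : measure_display} {Omega : measurableType disp}.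
Context {dispX : measure_display} {Xi : measurableType dispX}.
Variable P : probability Omega R.
Variable S : set 'rV[R]_d.
Variable fi : 'I_n -> 'rV[R]_d -> R.
Variable gfi : 'I_n -> 'rV[R]_d -> 'rV[R]_d.
Variable x0 : 'rV[R]_d.
Variable eta : nat -> R.
Variable g : 'I_n -> 'rV[R]_d -> Xi -> 'rV[R]_d.
Variable xi : nat -> Omega -> Xi.
Variable tau : 'I_n -> nat -> Omega -> int.
Variable x : nat -> Omega -> 'rV[R]_d.
Variable gtilde : 'I_n -> nat -> Omega -> 'rV[R]_d.

Definition objective (y : 'rV[R]_d) : R := \sum_(i < n) fi i y.

Definition fstar : R := inf (objective @` S).

Definition sigma_x (t : nat) : set (set Omega) :=
  g_sigma_algebra_preimage (x t : Omega -> borel_rV R d).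

Definition estimate (i : 'I_n) (t : nat) (w : Omega) : 'rV[R]_d :=
  g i (x t w) (xi t w).

(* A negative time stamp means that agent i has not been heard from. *)
Definition aggregate (t : nat) (w : Omega) : 'rV[R]_d :=
  \sum_(i < n) (if tau i t w is Posz s then estimate i s w else 0).

Definition delay (it : 'I_n * nat) (w : Omega) : int :=
  it.2%:Z - tau it.1 it.2 w.

Record delayed_projected_sgd : Prop := DelayedProjectedSgd {
  domain_closed : closed S;
  domain_convex : @convex_set R 'rV[R]_d S;
  agents_gt0 : (0 < n)%N;
  start_in_domain : S x0;
  stepsize_gt0 : forall t, 0 < eta t;
  noise_measurable : forall t, measurable_fun setT (xi t);
  estimator_measurable : forall i,
    @measurable_fun _ _ (borel_rV R d * Xi)%type (borel_rV R d)
      (S `*` setT) (fun p => g i p.1 p.2);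
  stamp_measurable : forall i t, measurable_fun setT (tau i t);
  stamp_range : forall i t w, -1 <= tau i t w <= t%:Z;
  noise_indep : forall t,
    indep P (g_sigma_algebra_preimage (xi t)) (sigma_x t);
  (* The whole family of delays is independent of the whole family of noises
     (and, with delay_indep below, each delay is independent of the past). A delay
     correlated with the noise could select biased estimates. *)
  delay_noise_indep : indep P (sigma_family delay) (sigma_family xi);
  iterate0 : forall w, x 0%N w = x0;
  iterateS : forall t w, x t.+1 w = eproj S (x t w - eta t *: aggregate t w) }.

Record objective_assumption (L : R) : Prop := ObjectiveAssumption {
  objective_lbound : has_lbound (objective @` S);
  objective_C1 : continuously_differentiable_on S objective;
  local_gradient : forall i, gradient_on S (fi i) (gfi i);
  local_smooth : forall i y z, S y -> S z ->
    enorm (gfi i y - gfi i z) <= L * enorm (y - z) }.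

(* gtilde i t is an arbitrary version of the conditional expectation of the
   estimate, hence the almost sure bounds. *)
Record estimator_assumption (L G : R) (q : nat -> R) : Prop :=
    EstimatorAssumption {
  gtilde_cond_expectation : forall i t,
    cond_expectation_rV P (sigma_x t) (estimate i t) (gtilde i t);
  second_moment_gt0 : 0 < G;
  second_moment : forall i t, exists V : Omega -> R,
    cond_expectation P (sigma_x t) (fun w => enorm (estimate i t w) ^+ 2) V /\
    {ae P, forall w, V w <= G};
  gtilde_lipschitz : forall i t1 t2, {ae P, forall w,
    enorm (gtilde i t1 w - gtilde i t2 w) <= L * enorm (x t1 w - x t2 w)};
  bias_ge0 : forall t, 0 <= q t;
  bias_bound : forall i t, {ae P, forall w,
    enorm (gtilde i t w - gfi i (x t w)) <= q t} }.

Record delay_assumption (C kappa : R) : Prop := DelayAssumption {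
  delay_indep : mutually_indep P (fun it => g_sigma_algebra_preimage (delay it));
  delay_moment_gt0 : 0 < C;
  delay_moment : forall i t,
    ('E_P[fun w => (((delay (i, t) w)%:~R : R) ^+ 2)%R] <= C%:E)%E;
  kappa_itv : 0 < kappa < 1;
  delay_linear : forall i t, {ae P, forall w,
    (delay (i, t) w)%:~R <= (1 - kappa) * t%:R :> R} }.

Definition weighted_average (T : nat) (w : Omega) : 'rV[R]_d :=
  \sum_(0 <= t < T.+1) (eta t / \sum_(0 <= s < T.+1) eta s) *: x t w.

(* fine is only meaningful when the integrand is integrable, which has to be
   asserted alongside. *)
Definition expected_gap (T : nat) : R :=
  fine 'E_P[objective \o weighted_average T] - fstar.

End Algorithm.

Definition nat_ceil {R : realType} (r : R) : nat := `|Num.ceil r|%N.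

(* Main.v *)
Require Import Defs.
From mathcomp Require Import all_boot all_order all_algebra.
From mathcomp Require Import finmap ring lra.
From mathcomp Require Import all_classical all_reals all_analysis measurable_realfun.

Set Implicit Arguments.
Unset Strict Implicit.
Unset Printing Implicit Defensive.

Import Order.TTheory GRing.Theory Num.Theory.
Import numFieldNormedType.Exports.

Local Open Scope classical_set_scope.
Local Open Scope ring_scope.

(** The squared distance to [xstar] satisfies
      E|x(t+1) - x*|^2 <= E|x(t) - x*|^2 - 2 eta(t) E<g(t), x(t) - x*> + eta(t)^2 n^2 G.
    The event [tau i t = u] is independent of the noise and of all delays before
    time t, hence of x(t) and of the estimate taken at time u: the inner product
    splits over u into P(tau i t = u) E<g_i(x(u), xi(u)), x(t) - x*>. Replacing the
    stale estimate by the gradient at x(t) costs a multiple of the sum of eta over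
    [u, t), which bounds the drift x(t) - x(u), and of q(t). Since u >= kappa t, each
    of these step sizes is at most M eta(t), and the second moment of the delay
    bounds the expected number of them. Convexity bounds the remaining inner product
    from below by f(x(t)) - f*; the sum over t telescopes, and Jensen's inequality
    passes to the weighted average. *)

(** * Euclidean geometry *)

(** The obstacle is that x(t) depends on the noise used at an earlier time u, so a stale estimate
    cannot be averaged against x(t) - [xstar]. It can be averaged against x(u) - [xstar], because
    the conditioning is on x(u) alone. The comparison with the gradient at x(t) therefore passes
    through x(u): apart from a centred term of mean zero, every difference carries a factor |x(t) -
    x(u)| or q(t). Since S may be unbounded, gradients and iterates have no pointwise bound. Each
    product is split by Young's inequality into second moments, which G, R and smoothness control.
    The expected delay that remains is at most C because an integer is at most its square. The
    convergence of the step size ratio enters through M: a convergent sequence is bounded from t = 0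
    on, as the telescoping sum requires. The initial distance, bounded by R, has no counterpart in
    the stated rate; it is absorbed because the sum of eta(t)^2 is at least eta(0)^2. *)

Section EuclideanTheory.
Context {R : realType} {d : nat}.
Implicit Types (x y u v : 'rV[R]_d) (S : set 'rV[R]_d) (c : R).

Lemma dotrC u v : dotr u v = dotr v u.
Proof. by apply: eq_bigr => j _; rewrite mulrC. Qed.

Lemma dotrDl u v x : dotr (u + v) x = dotr u x + dotr v x.
Proof. by rewrite -big_split; apply: eq_bigr => j _; rewrite mxE mulrDl. Qed.

Lemma dotrZl c u x : dotr (c *: u) x = c * dotr u x.
Proof. by rewrite mulr_sumr; apply: eq_bigr => j _; rewrite mxE mulrA. Qed.

Lemma dotrDr u v x : dotr x (u + v) = dotr x u + dotr x v.
Proof. by rewrite dotrC dotrDl !(dotrC x). Qed.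

Lemma dotrZr c u x : dotr x (c *: u) = c * dotr x u.
Proof. by rewrite dotrC dotrZl dotrC. Qed.

Lemma dotrNl u x : dotr (- u) x = - dotr u x.
Proof. by rewrite -scaleN1r dotrZl mulN1r. Qed.

Lemma dotrNr u x : dotr x (- u) = - dotr x u.
Proof. by rewrite dotrC dotrNl dotrC. Qed.

Definition dotrE := (dotrDl, dotrDr, dotrNl, dotrNr, dotrZl, dotrZr).

Lemma dotr0l x : dotr 0 x = 0.
Proof. by rewrite -(scale0r (0 : 'rV[R]_d)) dotrZl mul0r. Qed.

Lemma dotr_suml (I : Type) (r : seq I) (Q : pred I) (F : I -> 'rV[R]_d) x :
  dotr (\sum_(i <- r | Q i) F i) x = \sum_(i <- r | Q i) dotr (F i) x.
Proof.
by apply: (big_morph (dotr^~ x) (fun u v => dotrDl u v x)); rewrite dotr0l.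
Qed.

Lemma dotr_ge0 u : 0 <= dotr u u.
Proof. by apply: sumr_ge0 => j _; rewrite -expr2 sqr_ge0. Qed.

Lemma enorm_ge0 u : 0 <= enorm u.
Proof. exact: sqrtr_ge0. Qed.

Lemma enorm_sqr u : enorm u ^+ 2 = dotr u u.
Proof. by rewrite sqr_sqrtr// dotr_ge0. Qed.

Lemma coord_le_enorm u j : `|u 0 j| <= enorm u.
Proof.
rewrite -(@ler_pXn2r _ 2) ?nnegrE ?enorm_ge0// enorm_sqr real_normK ?num_real//.
rewrite /dotr (bigD1 j)//= -expr2 lerDl.
by apply: sumr_ge0 => k _; rewrite -expr2 sqr_ge0.
Qed.

Lemma enorm0 : enorm (0 : 'rV[R]_d) = 0.
Proof. by rewrite /enorm dotr0l sqrtr0. Qed.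

Lemma enorm_eq0 u : enorm u = 0 -> u = 0.
Proof.
move=> u0; apply/rowP => j; rewrite mxE; apply/eqP; rewrite -normr_eq0.
by rewrite eq_le normr_ge0 andbT -u0 coord_le_enorm.
Qed.

Lemma enormZ c u : enorm (c *: u) = `|c| * enorm u.
Proof.
by rewrite /enorm !dotrE mulrA -expr2 sqrtrM ?sqr_ge0// sqrtr_sqr.
Qed.

Lemma enormN u : enorm (- u) = enorm u.
Proof. by rewrite /enorm !dotrE opprK. Qed.

Lemma enormBC u v : enorm (u - v) = enorm (v - u).
Proof. by rewrite -enormN opprB. Qed.

Lemma enorm_sqrD u v :
  enorm (u + v) ^+ 2 = enorm u ^+ 2 + 2 * dotr u v + enorm v ^+ 2.
Proof. by rewrite !enorm_sqr !dotrE (dotrC v u); ring. Qed.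

Lemma enorm_sqrB u v :
  enorm (u - v) ^+ 2 = enorm u ^+ 2 - 2 * dotr u v + enorm v ^+ 2.
Proof. by rewrite enorm_sqrD enormN dotrE; ring. Qed.

Lemma cauchy_schwarz u v : `|dotr u v| <= enorm u * enorm v.
Proof.
rewrite -(@ler_pXn2r _ 2) ?nnegrE ?mulr_ge0 ?enorm_ge0//.
rewrite real_normK ?num_real// exprMn !enorm_sqr.
have [u0|] := ltP 0 (dotr u u); last first.
  rewrite le_eqVlt ltNge dotr_ge0 orbF => /eqP u0.
  have -> : u = 0 by apply: enorm_eq0; rewrite /enorm u0 sqrtr0.
  by rewrite !dotr0l mul0r expr0n.
(* The squared norm of this vector is |u|^2 (|u|^2 |v|^2 - <u,v>^2), and its first factor is
   positive here. *)
have := dotr_ge0 (dotr u u *: v - dotr u v *: u).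
rewrite !dotrE (dotrC v u) => h.
rewrite -subr_ge0 -(pmulr_rge0 _ u0); apply: le_trans h _.
by rewrite le_eqVlt; apply/orP; left; apply/eqP; ring.
Qed.

Lemma dotr_le u v : dotr u v <= enorm u * enorm v.
Proof. exact: le_trans (ler_norm _) (cauchy_schwarz _ _). Qed.

Lemma enormD u v : enorm (u + v) <= enorm u + enorm v.
Proof.
rewrite -(@ler_pXn2r _ 2) ?nnegrE ?addr_ge0 ?enorm_ge0//.
by rewrite enorm_sqrD; have := dotr_le u v; nra.
Qed.

Lemma enorm_sum (I : Type) (r : seq I) (Q : pred I) (F : I -> 'rV[R]_d) :
  enorm (\sum_(i <- r | Q i) F i) <= \sum_(i <- r | Q i) enorm (F i).
Proof.
elim/big_rec2 : _ => [|i a b _ h]; first by rewrite enorm0.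
by apply: le_trans (enormD _ _) _; rewrite lerD2l.
Qed.

Lemma normr_le_enorm u : `|u| <= enorm u.
Proof.
rewrite [leLHS]/Num.norm/= mx_normrE; apply/bigmax_leP; split=> [|[i j] _ /=].
  exact: enorm_ge0.
by rewrite (ord1 i) coord_le_enorm.
Qed.

Lemma coord_le_normr u j : `|u 0 j| <= `|u|.
Proof.
rewrite [leRHS]/Num.norm/= mx_normrE.
exact: (le_bigmax _ (fun ij => `|u ij.1 ij.2|) (0, j)).
Qed.

Lemma enorm_le_sum u : enorm u <= \sum_(j < d) `|u 0 j|.
Proof.
rewrite -(@ler_pXn2r _ 2) ?nnegrE ?sumr_ge0 ?enorm_ge0//.
rewrite enorm_sqr /dotr expr2 mulr_suml ler_sum// => j _.
have h : `|u 0 j| <= \sum_(k < d) `|u 0 k|.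
  by rewrite (bigD1 j)//= lerDl sumr_ge0.
apply: le_trans (ler_norm _) _; rewrite normrM.
exact: ler_wpM2l.
Qed.

(** With [normr_le_enorm], this carries Euclidean estimates over to the topology, which is given by
    the sup norm. The factor [d] is crude, but only continuity is at stake. *)
Lemma enorm_le_normr u : enorm u <= d%:R * `|u|.
Proof.
apply: le_trans (enorm_le_sum u) _.
rewrite mulr_natl -[X in _ *+ X](card_ord d) -sumr_const.
by apply: ler_sum => j _; exact: coord_le_normr.
Qed.

Lemma elipschitz_continuous (f : 'rV[R]_d -> 'rV[R]_d) c :
  (forall x y, enorm (f x - f y) <= c * enorm (x - y)) -> continuous f.
Proof.
move=> fl x; apply/(@cvgrPdist_le _ _ _ (nbhs x) (nbhs_filter x)) => e e0.
(* The sign of [c] is free and [d] may be 0, hence the absolute value and the added 1. *)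
have k0 : 0 < `|c| * d%:R + 1 by rewrite ltr_wpDl ?mulr_ge0.
near=> y.
apply: le_trans (normr_le_enorm _) _; apply: le_trans (fl _ _) _.
have : `|x - y| <= e / (`|c| * d%:R + 1).
  by near: y; apply: (@cvgr_dist_le _ _ _ (nbhs x) (nbhs_filter x) id x);
    [exact: cvg_id|rewrite divr_gt0//].
rewrite ler_pdivlMr// => h.
apply: le_trans (ler_wpM2r (enorm_ge0 _) (ler_norm c)) _.
apply: le_trans (ler_wpM2l (normr_ge0 c) (enorm_le_normr _)) _.
by have := normr_ge0 (x - y); nra.
Unshelve. all: by end_near. Qed.

Lemma enorm_continuous : continuous (@enorm R d).
Proof.
move=> x; apply/(@cvgrPdist_le _ _ _ (nbhs x) (nbhs_filter x)) => e e0; near=> y.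
have h : `|enorm x - enorm y| <= d%:R * `|x - y|.
  apply: le_trans (enorm_le_normr _); rewrite ler_norml; apply/andP; split.
    by have := enormD (y - x) x; rewrite subrK (enormBC y x); lra.
  by have := enormD (x - y) y; rewrite subrK; lra.
apply: le_trans h _.
have : `|x - y| <= e / (d%:R + 1).
  near: y; apply: (@cvgr_dist_le _ _ _ (nbhs x) (nbhs_filter x) id x).
    exact: cvg_id.
  by rewrite divr_gt0// ltr_wpDl.
rewrite ler_pdivlMr ?ltr_wpDl// => h.
by have := normr_ge0 (x - y); nra.
Unshelve. all: by end_near. Qed.

End EuclideanTheory.

(** * Metric projection onto a closed convex set *)

Section Projection.
Context {R : realType} {d : nat}.
Variable S : set 'rV[R]_d.
Hypotheses (Sclosed : closed S) (Snonempty : S !=set0).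

Let nearest (y : 'rV[R]_d) : set 'rV[R]_d := [set z | S z /\ forall s, S s -> enorm (y - z) <= enorm (y - s)].

(** [eproj] chooses its value with [get], so nothing can be said about it before a nearest point is
    known to exist. *)
Lemma nearest_point_exists y : nearest y !=set0.
Proof.
have [s0 Ss0] := Snonempty.
have cont : continuous (fun z : 'rV[R]_d => enorm (y - z)).
  move=> z; apply: (@continuous_comp _ _ _ (fun z : 'rV[R]_d => y - z : 'rV[R]_d)).
    apply: (@cvgB R 'rV[R]_d _ (nbhs z) (nbhs_filter z)); [exact: cvg_cst|exact: cvg_id].
  exact: enorm_continuous.
(* Cutting [S] by the closed ball around [y] through [s0] gives compactness and keeps the minimum of
   the distance. *)
pose K := S `&` [set z | enorm (y - z) <= enorm (y - s0)].
have Kcompact : compact K.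
  apply: bounded_closed_compact.
    exists (`|y| + enorm (y - s0)); split; first exact: num_real.
    move=> r hr z [_ /= hz]; apply: le_trans (ltW hr).
    rewrite -[z](subKr y); apply: le_trans (ler_normB _ _) _.
    by rewrite lerD2l; exact: le_trans (normr_le_enorm _) hz.
  apply: closedI => //.
  apply: (@closed_comp _ _ (fun z : 'rV[R]_d => enorm (y - z)) [set r | r <= enorm (y - s0)]).
    by move=> z _; exact: cont.
  exact: closed_le.
have Kne : K !=set0 by exists s0; split => //=.
have [|z Kz zmin] := @compact_EVT_min _ R (fun z : 'rV[R]_d => enorm (y - z)) K Kne Kcompact.
  by apply: continuous_subspaceT.
move: Kz; rewrite inE => -[Sz hz]; exists z; split => // s Ss.
have [hs|/ltW hs] := leP (enorm (y - s)) (enorm (y - s0)).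
  by apply: zmin; rewrite inE.
exact: le_trans hz hs.
Qed.

Lemma eproj_mem y : S (eproj S y).
Proof. by have [] := getPex (nearest_point_exists y). Qed.

Lemma eproj_min y s : S s -> enorm (y - eproj S y) <= enorm (y - s).
Proof.
by have [_] := getPex (nearest_point_exists y); apply.
Qed.

Lemma eproj_id y : S y -> eproj S y = y.
Proof.
move=> Sy; have := eproj_min y Sy; rewrite subrr enorm0 => h.
apply/esym/eqP; rewrite -subr_eq0; apply/eqP/enorm_eq0/eqP.
by rewrite eq_le h enorm_ge0.
Qed.

Hypothesis Sconvex : @convex_set R 'rV[R]_d S.

Lemma convex_set_segment x y (t : R) : S x -> S y -> 0 <= t <= 1 ->
  S (t *: x + (1 - t) *: y).
Proof.
move=> Sx Sy /andP[t0 t1].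
have := @Sconvex x y (Itv01 t0 t1); rewrite !inE; exact.
Qed.

Lemma eproj_obtuse y s : S s -> dotr (y - eproj S y) (s - eproj S y) <= 0.
Proof.
set p := eproj S y => Ss; rewrite leNgt; apply/negP => h.
set a := dotr _ _ in h.
set b := enorm (s - p) ^+ 2.
have b0 : 0 <= b by exact: sqr_ge0.
(* Moving from [p] towards [s] by [t] changes the squared distance to [y] by - 2 t a + t^2 b. With
   this [t] one has t b < a, so the change is negative; the denominator is positive even when b =
   0. *)
pose t := a / (a + b).
have ab0 : 0 < a + b by lra.
have t0 : 0 < t by rewrite divr_gt0.
have t1 : t <= 1 by rewrite ler_pdivrMr//; lra.
have tab : t * (a + b) = a by rewrite /t; field; lra.
have Sz := @convex_set_segment s p t Ss (eproj_mem y) (introT andP (conj (ltW t0) t1)).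
have := eproj_min y Sz; rewrite -/p.
rewrite -(@ler_pXn2r _ 2) ?nnegrE ?enorm_ge0//.
rewrite (_ : y - (t *: s + (1 - t) *: p) = (y - p) - t *: (s - p)); last first.
  by rewrite scalerBl scalerBr scale1r; apply/rowP => j; rewrite !mxE; ring.
rewrite (enorm_sqrB (y - p)) !dotrZr -/a enormZ exprMn -/b (ger0_norm (ltW t0)).
by nra.
Qed.

(** Adding the two obtuse angle inequalities gives |p - r|^2 <= <y - z, p - r>; Cauchy-Schwarz then
    allows division by |p - r|, unless it is 0. *)
Lemma eproj_nonexpansive y z : enorm (eproj S y - eproj S z) <= enorm (y - z).
Proof.
have hy := eproj_obtuse y (eproj_mem z).
have hz := eproj_obtuse z (eproj_mem y).
set p := eproj S y in hy hz *; set r := eproj S z in hy hz *.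
have : enorm (p - r) ^+ 2 <= dotr (y - z) (p - r).
  by move: hy hz; rewrite enorm_sqr !dotrE; lra.
move=> /le_trans /(_ (dotr_le _ _)); have := enorm_ge0 (p - r); rewrite le_eqVlt.
move=> /predU1P[<- _|p0]; first exact: enorm_ge0.
by rewrite expr2 ler_pM2r.
Qed.

Lemma eproj_continuous : continuous (eproj S).
Proof.
apply: (@elipschitz_continuous _ _ _ 1) => x y.
by rewrite mul1r eproj_nonexpansive.
Qed.

(** Composition with the projection extends [f] continuously from [S] to the whole space. This
    yields Borel measurability of [f] along random vectors with values in [S]. *)
Lemma within_continuous_eproj (T : topologicalType) (f : 'rV[R]_d -> T) :
  {within S, continuous f} -> continuous (f \o eproj S).
Proof.
move=> fS y; have pS := eproj_mem y.
have := @subspace_continuousP _ S _ f; move=> /iffLR /(_ fS _ pS) fc.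
apply: cvg_comp fc => A; rewrite /within/= => /eproj_continuous.
apply: (@filterS _ (nbhs y)) => z /=; apply; exact: eproj_mem.
Qed.

End Projection.

(** * Gradients relative to a set, and the first-order convexity inequality *)

Section Gradient.
Context {R : realType} {d : nat}.
Variable S : set 'rV[R]_d.
Implicit Types (f : 'rV[R]_d -> R) (gf : 'rV[R]_d -> 'rV[R]_d).

Lemma gradient_on_sum (I : Type) (r : seq I) (F : I -> 'rV[R]_d -> R)
    (gF : I -> 'rV[R]_d -> 'rV[R]_d) :
  (forall i, gradient_on S (F i) (gF i)) ->
  gradient_on S (fun y => \sum_(i <- r) F i y) (fun y => \sum_(i <- r) gF i y).
Proof.
move=> hF; elim: r => [|i r IH] x Sx e e0.
  near=> y; rewrite !big_nil dotr0l !subrr normr0 mulr_ge0 ?enorm_ge0//.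
  exact: ltW.
have e20 : 0 < e / 2 by lra.
have := hF i x Sx _ e20; have := IH x Sx _ e20.
apply: filterS2 => y; rewrite !big_cons => h1 h2.
rewrite (_ : _ - _ = (F i y - F i x - dotr (gF i x) (y - x)) +
  (\sum_(j <- r) F j y - \sum_(j <- r) F j x - dotr (\sum_(j <- r) gF j x) (y - x))).
  by apply: le_trans (ler_normD _ _) _; move: h1 h2; nra.
by rewrite dotrDl; ring.
Unshelve. all: by end_near. Qed.

(** The remainder bound with [eps] = 1 gives |f y - f x| <= (|gf x| + 1) |y - x| near [x] in [S];
    [k] translates this into the sup norm. *)
Lemma gradient_on_continuous f gf :
  gradient_on S f gf -> {within S, continuous f}.
Proof.
move=> hf; apply/subspace_continuousP => x Sx.
apply/cvgrPdist_le => e e0.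
have := hf x Sx 1 ltr01; rewrite !near_withinE => h.
pose k := (enorm (gf x) + 1) * d%:R + 1.
have k0 : 0 < k by rewrite ltr_wpDl ?mulr_ge0 ?addr_ge0 ?enorm_ge0.
near=> y => Sy.
have /(_ Sy) hy : S y -> `|f y - f x - dotr (gf x) (y - x)| <= 1 * enorm (y - x).
  by near: y.
have : `|x - y| <= e / k.
  by near: y; apply: (@cvgr_dist_le _ _ _ (nbhs x) (nbhs_filter x) id x);
    [exact: cvg_id|rewrite divr_gt0//].
rewrite ler_pdivlMr// distrC => h1.
have h2 := cauchy_schwarz (gf x) (y - x).
have h3 := enorm_le_normr (y - x).
have g0 := enorm_ge0 (gf x).
rewrite distrC -(subrK (dotr (gf x) (y - x)) (f y - f x)).
apply: le_trans (ler_normD _ _) _; apply: le_trans (lerD hy h2) _.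
rewrite mul1r -[X in X + _]mul1r -mulrDl addrC.
apply: le_trans h1; rewrite /k mulrDr mulr1 mulrC.
apply: (@le_trans _ _ (d%:R * `|y - x| * (enorm (gf x) + 1))).
  by rewrite ler_wpM2r// addr_ge0.
by have := normr_ge0 (y - x); lra.
Unshelve. all: by end_near. Qed.

(** The gradient is only relative to [S], so it is tested along the segment from [x] to [y].
    Convexity bounds f z from above, the expansion at [x] bounds it from below, and division by [t]
    leaves an error of at most [e]. *)
Lemma convex_gradient_le f gf x y :
  @convex_set R 'rV[R]_d S -> @convex_function R 'rV[R]_d S f ->
  gradient_on S f gf -> S x -> S y -> f x + dotr (gf x) (y - x) <= f y.
Proof.
move=> Sc fc hf Sx Sy; rewrite -lerBrDl; apply/ler_addgt0Pr => e e0.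
pose N := enorm (y - x) + 1.
have N0 : 0 < N by rewrite ltr_wpDl ?enorm_ge0.
have eN0 : 0 < e / N by rewrite divr_gt0.
have := hf x Sx _ eN0; rewrite near_withinE => /(@nbhs_ballP R 'rV[R]_d)[/= r r0 hr].
(* Small enough for [z] to lie strictly inside the sup norm ball of radius [r]; the 2 gives
   strictness and the added 1 covers y = x. *)
pose t := Num.min 1 (r / (2 * (`|y - x| + 1))).
have t1 : t <= 1 by rewrite ge_min lexx.
have q0 : 0 < 2 * (`|y - x| + 1) by have := normr_ge0 (y - x); lra.
have t0 : 0 < t by rewrite lt_min ltr01 divr_gt0.
have tr : t * (2 * (`|y - x| + 1)) <= r.
  by rewrite -ler_pdivlMr// ge_min lexx orbT.
pose z := t *: y + (1 - t) *: x.
have zx : z - x = t *: (y - x).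
  by apply/rowP => j; rewrite !mxE; ring.
have Sz : S z by apply: convex_set_segment; rewrite // (ltW t0).
have fz : f z <= t * f y + (1 - t) * f x.
  by have := fc (Itv01 (ltW t0) t1) y x; rewrite !inE; exact.
have := hr z; rewrite -ball_normE /ball_/= => /(_ _ Sz).
rewrite distrC zx normrZ (ger0_norm (ltW t0)) => /(_ _)/wrap[].
  by have := normr_ge0 (y - x); nra.
rewrite enormZ dotrZr (ger0_norm (ltW t0)) ler_norml => /andP[h _].
rewrite -(ler_pM2l t0).
have : e / N * (t * enorm (y - x)) <= t * e.
  rewrite mulrCA ler_pM2l// mulrAC ler_pdivrMr// ler_pM2l// /N; lra.
nra.
Qed.

End Gradient.

(** * Borel measurability of random vectors *)

Section BorelVectors.
Context {R : realType} {d : nat}.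
Local Notation rV := (borel_rV R d).

Lemma continuous_measurable_rV (f : 'rV[R]_d -> 'rV[R]_d) :
  continuous f -> measurable_fun setT (f : rV -> rV).
Proof.
move=> /continuousP fc; apply: (@measurability _ _ rV rV setT f [set A : set 'rV[R]_d | open A]) => //.
move=> _ [A oA <-]; rewrite setTI; apply: sub_sigma_algebra; exact: fc.
Qed.

Lemma continuous_measurable_rV_real (f : 'rV[R]_d -> R) :
  continuous f -> measurable_fun setT (f : rV -> R).
Proof.
move=> /continuousP fc; apply: (@measurability _ _ rV _ setT f _ (RGenOInfty.measurableE R)) => //.
move=> _ [_ [a ->] <-]; rewrite setTI; apply: sub_sigma_algebra; apply: fc.
exact: interval_open.
Qed.

(** A countable base: boxes with rational centre and radius 1/(k+1). Choosing the radius below e/2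
    makes the distances from [x] to the centre and from the centre to [y] add up to less than
    [e]. *)
Lemma open_rational_box (U : set 'rV[R]_d) (x : 'rV[R]_d) : open U -> U x ->
  exists c : 'rV[rat]_d, exists k : nat,
    (forall j, `|x 0 j - ratr (c 0 j)| < k.+1%:R^-1) /\
    (forall y : 'rV[R]_d, (forall j, `|y 0 j - ratr (c 0 j)| < k.+1%:R^-1) -> U y).
Proof.
move=> oU Ux; have := open_nbhs_nbhs (conj oU Ux) => /(@nbhs_ballP R 'rV[R]_d).
move=> [e /= e0 he]; have e20 : 0 < e / 2 by rewrite divr_gt0.
pose k := Num.Def.archi_bound (e / 2)^-1.
have k0 : (0 : R) < k.+1%:R^-1 by rewrite invr_gt0.
have ke : k.+1%:R^-1 < e / 2.
  rewrite invf_plt ?posrE//.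
  apply: lt_trans (archi_boundP _) _; first by rewrite invr_ge0 ltW.
  by rewrite ltr_nat.
have /choice[c hc] (j : 'I_d) : exists r : rat, `|x 0 j - ratr r| < k.+1%:R^-1.
  have /rat_in_itvoo[r] : x 0 j - k.+1%:R^-1 < x 0 j by rewrite ltrBlDr ltrDl.
  rewrite in_itv/= => /andP[r1 r2]; exists r.
  by rewrite gtr0_norm ?subr_gt0//; rewrite ltrBlDr addrC -ltrBlDr.
exists (\row_j c j), k; split => [j|y hy]; first by rewrite mxE.
apply: he; split=> // i j; rewrite (ord1 i) /ball/= .
have := hy j; have := hc j; rewrite mxE => h1 h2.
rewrite -(subrK (ratr (c j)) (x 0 j)) -addrA.
apply: le_lt_trans (ler_normD _ _) _; rewrite (distrC (ratr _)).
by move: (k.+1%:R^-1) h1 h2 ke => r; lra.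
Qed.

Context {disp : measure_display} {T : measurableType disp}.
Implicit Types X Y : T -> 'rV[R]_d.

Definition rv_measurable (X : T -> 'rV[R]_d) :=
  measurable_fun setT (X : T -> rV).

Lemma rv_measurableP X :
  rv_measurable X <->
  forall j, measurable_fun setT (fun w => X w 0 j).
Proof.
split=> [mX j|mX].
  apply: (measurableT_comp (continuous_measurable_rV_real (@coord_continuous R 1 d 0 j))).
  exact: mX.
apply: (@measurability _ _ T rV setT X [set A : set 'rV[R]_d | open A]) => //.
move=> _ [U oU <-].
rewrite setTI.
pose box (ck : 'rV[rat]_d * nat) : set 'rV[R]_d :=
  [set y | forall j, `|y 0 j - ratr (ck.1 0 j)| < ck.2.+1%:R^-1].
(* Boxes not contained in [U] contribute the empty set, so the union runs over the whole countable
   type of pairs. *)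
pose F ck := if `[< box ck `<=` U >] then X @^-1` box ck else set0.
have -> : X @^-1` U = \bigcup_ck F ck.
  apply/seteqP; split => [w Uw|w [ck _]].
    have [c [k [h1 h2]]] := open_rational_box oU Uw.
    exists (c, k) => //; rewrite /F; case: asboolP => // -[]; exact: h2.
  by rewrite /F; case: asboolP => // bU /bU.
apply: countable_bigcupT_measurable => // ck; rewrite /F.
case: asboolP => // _.
rewrite (_ : X @^-1` _ = \bigcap_(j in [set: 'I_d])
    ((fun w => `|X w 0 j - ratr (ck.1 0 j)|) @^-1` `]-oo, ck.2.+1%:R^-1[%classic)).
  apply: fin_bigcap_measurable => // j _; rewrite -[X in measurable X]setTI.
  apply: (_ : measurable_fun setT (fun w => `|X w 0 j - ratr (ck.1 0 j)|)) => //.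
  apply: measurableT_comp => //; apply: measurable_funB => //; exact: mX.
by apply/seteqP; split => w /= h j; [move=> _|]; have := h j; rewrite /= in_itv//=; exact.
Qed.

Lemma rv_measurable_cst (v : 'rV[R]_d) : rv_measurable (cst v).
Proof. exact: measurable_cst. Qed.

Lemma rv_measurableD X Y : rv_measurable X -> rv_measurable Y ->
  rv_measurable (fun w => X w + Y w).
Proof.
move=> /rv_measurableP mX /rv_measurableP mY; apply/rv_measurableP => j.
by under eq_fun do rewrite mxE; apply: measurable_funD; [exact: mX|exact: mY].
Qed.

Lemma rv_measurableZ (c : R) X : rv_measurable X ->
  rv_measurable (fun w => c *: X w).
Proof.
move=> /rv_measurableP mX; apply/rv_measurableP => j.
by under eq_fun do rewrite mxE; apply: measurable_funM => //; exact: mX.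
Qed.

Lemma rv_measurableB X Y : rv_measurable X -> rv_measurable Y ->
  rv_measurable (fun w => X w - Y w).
Proof.
move=> mX /(rv_measurableZ (-1)) mY.
by have := rv_measurableD mX mY; under eq_fun do rewrite scaleN1r.
Qed.

Lemma rv_measurable_sum (I : Type) (r : seq I) (F : I -> T -> 'rV[R]_d) :
  (forall i, rv_measurable (F i)) -> rv_measurable (fun w => \sum_(i <- r) F i w).
Proof.
move=> mF; apply/rv_measurableP => j; under eq_fun do rewrite summxE.
by apply: measurable_sum => i; exact: (rv_measurableP _).1.
Qed.

Lemma measurable_dotr X Y : rv_measurable X -> rv_measurable Y ->
  measurable_fun setT (fun w => dotr (X w) (Y w)).
Proof.
move=> /rv_measurableP mX /rv_measurableP mY; apply: measurable_sum => j.
by apply: measurable_funM; [exact: mX|exact: mY].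
Qed.

Lemma measurable_enorm X : rv_measurable X ->
  measurable_fun setT (fun w => enorm (X w)).
Proof.
move=> mX; apply: (@measurableT_comp _ _ _ T rV R (@enorm R d) setT X _ mX).
by apply: continuous_measurable_rV_real; exact: enorm_continuous.
Qed.

Lemma continuous_rv_measurable (f : 'rV[R]_d -> 'rV[R]_d) X :
  continuous f -> rv_measurable X -> rv_measurable (fun w => f (X w)).
Proof.
move=> fc mX; apply: (@measurableT_comp _ _ _ T rV rV f setT X _ mX).
exact: continuous_measurable_rV.
Qed.

Lemma continuous_rv_measurable_real (f : 'rV[R]_d -> R) X :
  continuous f -> rv_measurable X -> measurable_fun setT (fun w => f (X w)).
Proof.
move=> fc mX; apply: (@measurableT_comp _ _ _ T rV R f setT X _ mX).
exact: continuous_measurable_rV_real.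
Qed.

End BorelVectors.

(** * Expectations *)

Import HBNNSimple.

Section Mean.
Context {R : realType} {disp : measure_display} {Omega : measurableType disp}.
Variable P : probability Omega R.
Implicit Types (X Y : Omega -> R) (c : R).

Definition rintegrable X := P.-integrable setT (EFin \o X).

Definition mean X : R := \int[P]_w X w.

Lemma rintegrable_measurable X : rintegrable X -> measurable_fun setT X.
Proof. by move=> /measurable_int/measurable_EFinP. Qed.

Lemma rintegrable_cst c : rintegrable (cst c).
Proof. exact: finite_measure_integrable_cst. Qed.

Lemma rintegrableD X Y : rintegrable X -> rintegrable Y ->
  rintegrable (fun w => X w + Y w).
Proof. by move=> iX iY; apply: (integrableD _ iX iY). Qed.

Lemma rintegrableZ c X : rintegrable X -> rintegrable (fun w => c * X w).
Proof. by move=> iX; apply: (integrableZl _ c iX). Qed.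

Lemma rintegrableB X Y : rintegrable X -> rintegrable Y ->
  rintegrable (fun w => X w - Y w).
Proof. by move=> iX iY; apply: (integrableB _ iX iY). Qed.

Lemma rintegrable_sum (I : Type) (r : seq I) (F : I -> Omega -> R) :
  (forall i, rintegrable (F i)) -> rintegrable (fun w => \sum_(i <- r) F i w).
Proof.
move=> hF; elim: r => [|i r IH].
  by under eq_fun do rewrite big_nil; exact: rintegrable_cst.
by under eq_fun do rewrite big_cons; exact: rintegrableD.
Qed.

Lemma rintegrable_le X Y : measurable_fun setT X -> rintegrable Y ->
  (forall w, `|X w| <= Y w) -> rintegrable X.
Proof.
move=> mX iY XY; apply: le_integrable iY => //; first exact/measurable_EFinP.
by move=> w _; rewrite /= lee_fin (le_trans (XY w))// ler_norm.
Qed.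

Lemma mean_cst c : mean (cst c) = c.
Proof. by rewrite /mean Rintegral_cst//= probability_setT mulr1. Qed.

Lemma meanD X Y : rintegrable X -> rintegrable Y ->
  mean (fun w => X w + Y w) = mean X + mean Y.
Proof. by move=> iX iY; exact: RintegralD. Qed.

Lemma meanB X Y : rintegrable X -> rintegrable Y ->
  mean (fun w => X w - Y w) = mean X - mean Y.
Proof. by move=> iX iY; exact: RintegralB. Qed.

Lemma meanZ c X : rintegrable X -> mean (fun w => c * X w) = c * mean X.
Proof. by move=> iX; exact: RintegralZl. Qed.

Lemma mean_sum (I : Type) (r : seq I) (F : I -> Omega -> R) :
  (forall i, rintegrable (F i)) ->
  mean (fun w => \sum_(i <- r) F i w) = \sum_(i <- r) mean (F i).
Proof.
move=> hF; elim: r => [|i r IH].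
  by under [in LHS]eq_fun do rewrite big_nil; rewrite big_nil mean_cst.
under [in LHS]eq_fun do rewrite big_cons.
by rewrite meanD ?big_cons ?IH//; exact: rintegrable_sum.
Qed.

Lemma mean_le X Y : rintegrable X -> rintegrable Y ->
  (forall w, X w <= Y w) -> mean X <= mean Y.
Proof. by move=> iX iY XY; apply: le_Rintegral. Qed.

Lemma mean_ge0 X : (forall w, 0 <= X w) -> 0 <= mean X.
Proof. by move=> X0; apply: Rintegral_ge0. Qed.

Lemma rintegrable_ae_le X Y : measurable_fun setT X -> rintegrable Y ->
  {ae P, forall w, `|X w| <= Y w} -> rintegrable X.
Proof.
move=> mX iY XY; apply/integrableP; split; first exact/measurable_EFinP.
have /integrableP[mY] := iY; apply: le_lt_trans.
apply: ae_ge0_le_integral => //.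
- by apply: measurableT_comp => //; exact/measurable_EFinP.
- by apply: measurableT_comp.
- by apply: filterS XY => w h _; rewrite /= lee_fin (le_trans h)// ler_norm.
Qed.

(** The inequality becomes pointwise after replacing [X] by min(X, Y), which equals [X] almost
    everywhere. *)
Lemma mean_ae_le X Y : rintegrable X -> rintegrable Y ->
  {ae P, forall w, X w <= Y w} -> mean X <= mean Y.
Proof.
move=> iX iY XY.
have mX := rintegrable_measurable iX; have mY := rintegrable_measurable iY.
pose Z w := Num.min (X w) (Y w).
have mZ : measurable_fun setT Z by exact: measurable_minr.
have iZ : rintegrable Z.
  apply: (@rintegrable_le _ (fun w => `|X w| + `|Y w|)) => //.
    by apply: rintegrableD; apply: integrable_norm.
  move=> w; rewrite /Z; case: (leP (X w) (Y w)) => _; first by rewrite lerDl.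
  by rewrite lerDr.
have -> : mean X = mean Z.
  congr fine; apply: ae_eq_integral => //; try exact/measurable_EFinP.
  by apply: filterS XY => w h _; rewrite /Z min_l.
by apply: mean_le => // w; rewrite /Z ge_min lexx orbT.
Qed.

Lemma mean_ae_eq0 X : {ae P, forall w, X w = 0} -> measurable_fun setT X ->
  mean X = 0.
Proof.
move=> X0 mX; rewrite -(mean_cst 0); congr fine.
apply: ae_eq_integral; [by []|exact/measurable_EFinP|exact: (@measurable_cst _ _ _ _ setT (0%:E : \bar R))|].
by apply: filterS X0 => w h _ /=; rewrite h.
Qed.

Lemma mean_EFin X : rintegrable X -> (mean X)%:E = (\int[P]_w (X w)%:E)%E.
Proof. by move=> iX; rewrite fineK// integrable_fin_num. Qed.

(** The moment hypotheses bound extended real expectations. For a nonnegative variable such a bound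
    already contains integrability, so the passage to the real-valued [mean] is faithful. *)
Lemma expectation_le_rintegrable X c : measurable_fun setT X ->
  (forall w, 0 <= X w) -> ('E_P[X] <= c%:E)%E -> rintegrable X /\ mean X <= c.
Proof.
move=> mX X0; rewrite unlock => h.
have iX : rintegrable X.
  apply/integrableP; split; first exact/measurable_EFinP.
  apply: le_lt_trans (ltry c).
  by under eq_integral do rewrite /= ger0_norm//.
by split=> //; rewrite -lee_fin mean_EFin.
Qed.

(** * From orthogonality to events to orthogonality to functions *)

Section Orthogonality.
Context {disp' : measure_display} {T : measurableType disp'}.
Variables (phi : Omega -> T) (X : Omega -> R).
Hypotheses (mphi : measurable_fun setT phi) (iX : rintegrable X).
Hypothesis X_orthogonal : forall B : set T, measurable B ->
  mean (fun w => X w * \1_B (phi w)) = 0.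

Let mX := rintegrable_measurable iX.

Let mean_orthogonal_sfun (k : {nnsfun T >-> R}) :
  mean (fun w => X w * k (phi w)) = 0.
Proof.
under eq_fun do rewrite fimfunE fsbig_finite//= mulr_sumr.
rewrite mean_sum.
  rewrite big1 // => y _; under eq_fun do rewrite mulrCA.
  rewrite meanZ ?X_orthogonal ?mulr0//.
  apply: (@rintegrable_le _ (fun w => `|X w|)); last 2 first.
  - exact: integrable_norm.
  - move=> w; rewrite normrM ler_piMr// indicE; case: (_ \in _) => /=; by rewrite ?normr1 ?normr0.
  by apply: measurable_funM => //; apply: measurableT_comp => //; exact: measurable_indic.
move=> y; under eq_fun do rewrite mulrCA; apply: rintegrableZ.
apply: (@rintegrable_le _ (fun w => `|X w|)); last 2 first.
- exact: integrable_norm.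
- move=> w; rewrite normrM ler_piMr// indicE; case: (_ \in _) => /=; by rewrite ?normr1 ?normr0.
by apply: measurable_funM => //; apply: measurableT_comp => //; exact: measurable_indic.
Qed.

(** Simple functions increase to [h], hence |X k_n(phi)| <= |X h(phi)|: the product assumed
    integrable is itself the dominating function. *)
Let mean_orthogonal_ge0 (h : T -> R) : measurable_fun setT h ->
  (forall y, 0 <= h y) -> rintegrable (fun w => X w * h (phi w)) ->
  mean (fun w => X w * h (phi w)) = 0.
Proof.
move=> mh h0 iXh.
have mEh : measurable_fun setT (EFin \o h) by exact/measurable_EFinP.
pose k := nnsfun_approx measurableT mEh.
have kcvg y : k n y @[n --> \oo] --> h y.
  have cv : ((k n y)%:E @[n --> \oo] --> (h y)%:E)%E.
    by apply: (cvg_nnsfun_approx measurableT mEh) => // x _; rewrite lee_fin.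
  exact: fine_cvg cv.
have kle n y : k n y <= h y.
  rewrite -(cvg_lim _ (kcvg y))//; apply: nondecreasing_cvgn_le.
    by move=> a b ab; have /lefP := nd_nnsfun_approx measurableT mEh ab; exact.
  by apply/cvg_ex; exists (h y); exact: kcvg.
have [|||||_ _] := @dominated_convergence _ _ R P setT measurableT
  (fun n w => (X w * k n (phi w))%:E) (fun w => (X w * h (phi w))%:E)
  (fun w => `|X w * h (phi w)|%:E).
- move=> n; apply/measurable_EFinP; apply: measurable_funM => //.
  exact: measurableT_comp.
- exact: measurable_int iXh.
- apply/aeW => w _; apply: cvg_EFin; first by near=> n.
  by apply: cvgMr; exact: kcvg.
- exact: integrable_norm iXh.
- apply/aeW => w n _; rewrite /= lee_fin !normrM ler_wpM2l//.
  by rewrite !ger0_norm.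
rewrite (_ : [sequence _]_n = cst 0%E); last first.
  apply/funext => n; rewrite /= -(@mean_EFin (fun w => X w * k n (phi w))) ?mean_orthogonal_sfun//.
  apply: (@rintegrable_le _ (fun w => `|X w * h (phi w)|)).
  - by apply: measurable_funM => //; exact: measurableT_comp.
  - exact: integrable_norm iXh.
  - by move=> w; rewrite !normrM ler_wpM2l// !ger0_norm.
move=> /(cvg_lim (@ereal_hausdorff R)); rewrite lim_cst// => h0'.
by rewrite /mean /Rintegral -h0'.
Unshelve. all: by end_near. Qed.

(* Only X * h(phi) has to be integrable, not h(phi) itself: this covers both
   conditional expectations and independence. *)
Lemma mean_orthogonal (h : T -> R) : measurable_fun setT h ->
  rintegrable (fun w => X w * h (phi w)) -> mean (fun w => X w * h (phi w)) = 0.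
Proof.
move=> mh iXh.
have mhp : measurable_fun setT (fun y => Num.max (h y) 0) by exact: measurable_maxr.
have mhn : measurable_fun setT (fun y => Num.max (- h y) 0).
  by apply: measurable_maxr => //; exact: measurableT_comp.
have ip : rintegrable (fun w => X w * Num.max (h (phi w)) 0).
  apply: (@rintegrable_le _ (fun w => `|X w * h (phi w)|)).
  - by apply: measurable_funM => //; exact: (measurableT_comp mhp).
  - exact: integrable_norm iXh.
  - move=> w; rewrite !normrM ler_wpM2l//.
    by case: (leP (h (phi w)) 0) => // _; rewrite normr0.
have i_n : rintegrable (fun w => X w * Num.max (- h (phi w)) 0).
  apply: (@rintegrable_le _ (fun w => `|X w * h (phi w)|)).
  - by apply: measurable_funM => //; exact: (measurableT_comp mhn).
  - exact: integrable_norm iXh.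
  - move=> w; rewrite !normrM ler_wpM2l//.
    by case: (leP (- h (phi w)) 0) => // _; rewrite ?normr0 ?normrN.
have -> : (fun w => X w * h (phi w)) =
    (fun w => X w * Num.max (h (phi w)) 0 - X w * Num.max (- h (phi w)) 0).
  apply/funext => w; rewrite -mulrBr; congr (_ * _).
  by case: (leP (h (phi w)) 0) => h0; case: (leP (- h (phi w)) 0) => h1; lra.
rewrite meanB// [X in X - _](mean_orthogonal_ge0 mhp)//; last first.
  by move=> y; rewrite le_max lexx orbT.
rewrite [X in _ - X](mean_orthogonal_ge0 mhn) ?subrr// => y.
by rewrite le_max lexx orbT.
Qed.

End Orthogonality.
End Mean.

(** * Square-integrable random vectors *)

Section SquareIntegrable.
Context {R : realType} {disp : measure_display} {Omega : measurableType disp}.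
Context {d : nat}.
Variable P : probability Omega R.
Implicit Types (X Y : Omega -> 'rV[R]_d) (c : R).

Definition rv_L2 X := rv_measurable X /\ rintegrable P (fun w => enorm (X w) ^+ 2).

Lemma rv_L2_le X (h : Omega -> R) : rv_measurable X -> rintegrable P h ->
  (forall w, enorm (X w) ^+ 2 <= h w) -> rv_L2 X.
Proof.
move=> mX ih Xh; split=> //; apply: rintegrable_le ih _.
  by apply: measurable_funX; exact: measurable_enorm.
by move=> w; rewrite ger0_norm ?sqr_ge0.
Qed.

Lemma rv_L2_cst v : rv_L2 (cst v).
Proof. by split; [exact: rv_measurable_cst|exact: (rintegrable_cst P (enorm v ^+ 2))]. Qed.

Lemma rv_L2Z c X : rv_L2 X -> rv_L2 (fun w => c *: X w).
Proof.
move=> [mX iX]; apply: (rv_L2_le _ (rintegrableZ (c ^+ 2) iX)).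
  exact: rv_measurableZ.
by move=> w; rewrite enormZ exprMn real_normK ?num_real.
Qed.

Lemma rv_L2D X Y : rv_L2 X -> rv_L2 Y -> rv_L2 (fun w => X w + Y w).
Proof.
move=> [mX iX] [mY iY].
apply: (rv_L2_le _ (rintegrableD (rintegrableZ 2 iX) (rintegrableZ 2 iY))).
  exact: rv_measurableD.
move=> w; rewrite enorm_sqrD.
have := dotr_le (X w) (Y w); have := sqr_ge0 (enorm (X w) - enorm (Y w)).
by rewrite sqrrB; lra.
Qed.

Lemma rv_L2B X Y : rv_L2 X -> rv_L2 Y -> rv_L2 (fun w => X w - Y w).
Proof.
move=> hX /(rv_L2Z (-1)) hY; have := rv_L2D hX hY.
by under eq_fun do rewrite scaleN1r.
Qed.

Lemma rv_L2_sum (I : Type) (r : seq I) (F : I -> Omega -> 'rV[R]_d) :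
  (forall i, rv_L2 (F i)) -> rv_L2 (fun w => \sum_(i <- r) F i w).
Proof.
move=> hF; elim: r => [|i r IH].
  by under eq_fun do rewrite big_nil; exact: rv_L2_cst.
by under eq_fun do rewrite big_cons; exact: rv_L2D.
Qed.

Lemma rv_L2_enormM X Y : rv_L2 X -> rv_L2 Y ->
  rintegrable P (fun w => enorm (X w) * enorm (Y w)).
Proof.
move=> [mX iX] [mY iY]; apply: rintegrable_le (rintegrableD iX iY) _.
  by apply: measurable_funM; exact: measurable_enorm.
move=> w; rewrite ger0_norm ?mulr_ge0 ?enorm_ge0//.
by have := sqr_ge0 (enorm (X w) - enorm (Y w)); have := sqr_ge0 (enorm (X w));
  have := sqr_ge0 (enorm (Y w)); rewrite sqrrB; lra.
Qed.

Lemma rv_L2_dotr X Y : rv_L2 X -> rv_L2 Y -> rintegrable P (fun w => dotr (X w) (Y w)).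
Proof.
move=> hX hY; apply: rintegrable_le (rv_L2_enormM hX hY) _.
  by case: hX hY => mX _ [mY _]; exact: measurable_dotr.
by move=> w; exact: cauchy_schwarz.
Qed.

Lemma rv_L2_coordM X Y j : rv_L2 X -> rv_L2 Y ->
  rintegrable P (fun w => X w 0 j * Y w 0 j).
Proof.
move=> hX hY; apply: rintegrable_le (rv_L2_enormM hX hY) _.
  by case: hX hY => /rv_measurableP mX _ [/rv_measurableP mY _]; exact: measurable_funM.
by move=> w; rewrite normrM ler_pM ?coord_le_enorm.
Qed.

End SquareIntegrable.

Section ConditionalExpectation.
Context {R : realType} {disp : measure_display} {Omega : measurableType disp}.
Variable P : probability Omega R.
Context {disp' : measure_display} {T : measurableType disp'}.
Variable phi : Omega -> T.
Hypothesis mphi : measurable_fun setT phi.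

Lemma mean_indic (X : Omega -> R) (A : set Omega) :
  mean P (fun w => X w * \1_A w) = \int[P]_(w in A) X w.
Proof. by rewrite Rintegral_mkcond patch_indic. Qed.

Lemma rintegrable_indicM (X : Omega -> R) (A : set Omega) :
  measurable A -> rintegrable P X -> rintegrable P (fun w => \1_A w * X w).
Proof.
move=> mA iX; apply: (rintegrable_le _ (integrable_norm iX)).
  apply: measurable_funM; first exact: measurable_indic.
  exact: rintegrable_measurable iX.
by move=> w; rewrite normrM ler_piMl// indicE; case: (_ \in _) => /=; rewrite ?normr1 ?normr0.
Qed.

(** [X - Y] is orthogonal to every event of sigma(phi), and [mean_orthogonal] extends this to
    weights h(phi), which may be unbounded. *)
Lemma mean_cond_expectation (X Y : Omega -> R) (h : T -> R) :
  cond_expectation P (g_sigma_algebra_preimage phi) X Y -> measurable_fun setT h ->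
  rintegrable P (fun w => X w * h (phi w)) ->
  rintegrable P (fun w => Y w * h (phi w)) ->
  mean P (fun w => X w * h (phi w)) = mean P (fun w => Y w * h (phi w)).
Proof.
move=> [iX iY _ XY] mh iXh iYh; apply/eqP; rewrite -subr_eq0 -meanB//; apply/eqP.
under eq_fun do rewrite -mulrBl.
apply: (mean_orthogonal mphi (rintegrableB iX iY)) => // [B mB|]; last first.
  by under eq_fun do rewrite mulrBl; exact: rintegrableB.
have mA : measurable (phi @^-1` B) by rewrite -[X in measurable X]setTI; exact: mphi.
have iXA : rintegrable P (fun w => X w * \1_(phi @^-1` B) w).
  by under eq_fun do rewrite mulrC; exact: rintegrable_indicM.
have iYA : rintegrable P (fun w => Y w * \1_(phi @^-1` B) w).
  by under eq_fun do rewrite mulrC; exact: rintegrable_indicM.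
have -> : (fun w => (X w - Y w) * \1_B (phi w)) =
    (fun w => X w * \1_(phi @^-1` B) w - Y w * \1_(phi @^-1` B) w).
  by apply/funext => w; rewrite mulrBl.
rewrite meanB// !mean_indic /Rintegral XY ?subrr//.
by exists B => //; rewrite setTI.
Qed.

End ConditionalExpectation.

(** * Independence of a delay from the past *)

Section IndependentMean.
Context {R : realType} {disp : measure_display} {Omega : measurableType disp}.
Variable P : probability Omega R.
Context {disp' : measure_display} {T : measurableType disp'}.
Variable phi : Omega -> T.
Hypothesis mphi : measurable_fun setT phi.

(** Independence says that the centred indicator of [D] is orthogonal to every event of sigma(phi);
    [mean_orthogonal] does the rest. *)
Lemma mean_indep (D : set Omega) (h : T -> R) : measurable D ->
  (forall B, measurable B -> P (D `&` phi @^-1` B) = (P D * P (phi @^-1` B))%E) ->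
  measurable_fun setT h -> rintegrable P (fun w => h (phi w)) ->
  mean P (fun w => \1_D w * h (phi w)) = fine (P D) * mean P (fun w => h (phi w)).
Proof.
move=> mD hD mh ih.
have iD : rintegrable P (\1_D : Omega -> R) by exact: integrable_indic.
have iDh := rintegrable_indicM mD ih.
rewrite -meanZ//; apply/eqP; rewrite -subr_eq0 -meanB//; last exact: rintegrableZ.
apply/eqP; under eq_fun do rewrite -mulrBl.
apply: (mean_orthogonal mphi (rintegrableB iD (rintegrable_cst P _))) => // [B mB|]; last first.
  by under eq_fun do rewrite mulrBl; apply: rintegrableB => //; exact: rintegrableZ.
have mA : measurable (phi @^-1` B) by rewrite -[X in measurable X]setTI; exact: mphi.
have iA : rintegrable P (\1_(phi @^-1` B) : Omega -> R) by exact: integrable_indic.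
have -> : (fun w => (\1_D w - cst (fine (P D)) w) * \1_B (phi w)) =
    (fun w => \1_(D `&` phi @^-1` B) w - fine (P D) * \1_(phi @^-1` B) w).
  by apply/funext => w; rewrite mulrBl indicI.
have mean1 (A : set Omega) : measurable A -> mean P (\1_A : Omega -> R) = fine (P A).
  by move=> mA'; rewrite /mean /Rintegral integral_indic// setIT.
rewrite meanB ?meanZ ?mean1//.
- by rewrite hD// fineM ?fin_num_measure// subrr.
- exact: measurableI.
- by apply: integrable_indic; exact: measurableI.
- exact: rintegrableZ.
Qed.

End IndependentMean.

(** * One delay against all noises and a family of other delays *)

Section Cylinders.
Context {R : realType} {disp : measure_display} {Omega : measurableType disp}.
Variable P : probability Omega R.
Context {disp1 : measure_display} {T1 : measurableType disp1} {I : choiceType}.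
Context {disp2 : measure_display} {T2 : measurableType disp2} {K : Type}.
Variables (delta : I -> Omega -> T1) (xi : K -> Omega -> T2).
Hypotheses (mdelta : forall i, measurable_fun setT (delta i))
  (mxi : forall k, measurable_fun setT (xi k)).
Hypothesis delta_indep : mutually_indep P (fun i => g_sigma_algebra_preimage (delta i)).
Hypothesis delta_xi_indep : indep P (sigma_family delta) (sigma_family xi).

Let sdelta i := g_sigma_algebra_preimage (delta i).

(* The whole family xi is included, at all times: only the delays are filtered. *)
Definition cylinder (past : set I) : set (set Omega) :=
  [set A | exists J : {fset I}, exists D : I -> set Omega, exists B : set Omega,
    [/\ [set` J] `<=` past, forall i, sdelta i (D i), sigma_family xi B &
        A = \bigcap_(i in [set` J]) D i `&` B]].

Let sdelta_setI i A B : sdelta i A -> sdelta i B -> sdelta i (A `&` B).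
Proof.
move=> [U mU <-] [V mV <-]; exists (U `&` V); first exact: measurableI.
by rewrite !setTI preimage_setI.
Qed.

Let sdelta_setT i : sdelta i setT.
Proof. by exists setT => //; rewrite setTI preimage_setT. Qed.

Let sdelta_measurable i A : sdelta i A -> measurable A.
Proof. by move=> [U mU <-]; exact: mdelta. Qed.

Let sxi_measurable A : sigma_family xi A -> measurable A.
Proof.
apply: smallest_sub; first exact: sigma_algebra_measurable.
by move=> B [k _ [U mU <-]]; exact: mxi.
Qed.

Let sxi_setI A B : sigma_family xi A -> sigma_family xi B -> sigma_family xi (A `&` B).
Proof.
have /(sigma_algebraP (fun X _ => @subsetT _ X))[_ _ _] :=
  smallest_sigma_algebra setT (\bigcup_k g_sigma_algebra_preimage (xi k)).
exact.
Qed.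

Let sxi_setT : sigma_family xi setT.
Proof.
have /(sigma_algebraP (fun X _ => @subsetT _ X))[] :=
  smallest_sigma_algebra setT (\bigcup_k g_sigma_algebra_preimage (xi k)).
by [].
Qed.

(** Cylinders need not form a sigma-algebra, but a pi-system suffices for the uniqueness of measures
    used in [indep_cylinders]. The index sets are merged, and an index missing from one of them
    receives [setT] there. *)
Lemma cylinder_setI_closed past : setI_closed (cylinder past).
Proof.
move=> _ _ [J1 [D1 [B1 [J1p sD1 sB1 ->]]]] [J2 [D2 [B2 [J2p sD2 sB2 ->]]]].
exists (J1 `|` J2)%fset.
exists (fun i => (if i \in J1 then D1 i else setT) `&` (if i \in J2 then D2 i else setT)).
exists (B1 `&` B2); split.
- by rewrite set_fsetU subUset.
- by move=> i; apply: sdelta_setI; case: ifP.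
- exact: sxi_setI.
rewrite setIACA; congr (_ `&` _); apply/seteqP; split => w /=.
  move=> [h1 h2] i _; split.
    by case: ifPn => // iJ; exact: h1.
  by case: ifPn => // iJ; exact: h2.
move=> h; split => i /= iJ.
  by have := h i; rewrite /= !inE iJ => /(_ isT)[].
by have := h i; rewrite /= !inE iJ orbT => /(_ isT)[].
Qed.

Lemma cylinder_measurable past : cylinder past `<=` measurable.
Proof.
move=> _ [J [D [B [_ sD sB ->]]]]; apply: measurableI; last exact: sxi_measurable.
rewrite bigcap_fset; apply: big_ind => //; first exact: measurableI.
by move=> i _; exact: sdelta_measurable (sD i).
Qed.

Lemma cylinder_setT past : cylinder past setT.
Proof.
exists fset0, (fun=> setT), setT; split => //.
by rewrite setIT; apply/seteqP; split.
Qed.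

Lemma cylinder_delta past i A : past i -> sdelta i A -> cylinder past A.
Proof.
move=> pi sA; exists [fset i]%fset, (fun k => if k == i then A else setT), setT; split => //.
- by move=> k /=; rewrite inE => /eqP ->.
- by move=> k; case: eqP => [->|].
- rewrite setIT; apply/seteqP; split => [w Aw k /=|w].
    by rewrite inE => /eqP ->; rewrite eqxx.
  by move=> /(_ i); rewrite /= inE eqxx; exact.
Qed.

Lemma cylinder_xi past k A : g_sigma_algebra_preimage (xi k) A -> cylinder past A.
Proof.
move=> sA; exists fset0, (fun=> setT), A; split => //.
- by apply: sub_sigma_algebra; exists k.
- by rewrite set_fset0 bigcap_set0 setTI.
Qed.

(** The finite measures A -> P(A and D) and A -> P(D) P(A) agree on the pi-system of cylinders,
    hence on the sigma-algebra that it generates. *)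
Lemma indep_cylinders past i0 : ~ past i0 ->
  indep P (sdelta i0) <<s cylinder past >>.
Proof.
move=> npi0 D A sD.
have mD := sdelta_measurable sD.
have PD0 : 0 <= fine (P D) by exact: fine_ge0.
pose m1 : {measure set Omega -> \bar R} := mrestr P mD.
pose m2 : {measure set Omega -> \bar R} := mscale (NngNum PD0) P.
have m1E X : m1 X = P (X `&` D) by [].
have m2E X : m2 X = (P D * P X)%E.
  by transitivity ((fine (P D))%:E * P X)%E => //; rewrite fineK ?fin_num_measure.
move=> sA.
have : m1 A = m2 A.
  apply: (@g_sigma_algebra_measure_unique _ _ _ (cylinder past)
    (@cylinder_measurable past) (fun=> setT)) sA.
  - by move=> _; exact: cylinder_setT.
  - by rewrite bigcup_const.
  - exact: cylinder_setI_closed.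
  - move=> _ [J [E [B [Jp sE sB ->]]]].
    rewrite m1E m2E.
    have i0J : i0 \notin J by apply/negP => /Jp.
    (* As [i0] is outside [J], [D] can be inserted as one more delay factor. The set is then a delay
       event intersected with a noise event, and both independence hypotheses apply. *)
    pose E' i := if i == i0 then D else E i.
    have sE' i : sdelta i (E' i) by rewrite /E'; case: eqP => [->|].
    have E'i0 : E' i0 = D by rewrite /E' eqxx.
    have Prod (J' : {fset I}) (F : I -> set Omega) : (forall i, sdelta i (F i)) ->
        P (\bigcap_(i in [set` J']) F i) = (\prod_(i <- J') P (F i))%E.
      by move=> sF; apply: delta_indep => i _; exact: sF.
    have sFd (J' : {fset I}) (F : I -> set Omega) : (forall i, sdelta i (F i)) ->
        sigma_family delta (\bigcap_(i in [set` J']) F i).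
      move=> sF; have /(sigma_algebraP (fun X _ => @subsetT _ X))[sT _ _ sI] :=
        smallest_sigma_algebra setT (\bigcup_i g_sigma_algebra_preimage (delta i)).
      rewrite bigcap_fset; apply: big_ind => // i _.
      by apply: sub_sigma_algebra; exists i => //; exact: sF.
    have EE' : \bigcap_(i in [set` J]) E i = \bigcap_(i in [set` J]) E' i.
      apply: eq_bigcapr => i /= iJ; rewrite /E'; case: eqP => // ii0.
      by move: iJ; rewrite ii0 => /Jp.
    have -> : \bigcap_(i in [set` J]) E i `&` B `&` D =
        \bigcap_(i in [set` (i0 |` J)%fset]) E' i `&` B.
      by rewrite bigcap_fsetU1 EE' E'i0 setIC setIA.
    rewrite !delta_xi_indep//; [|exact: sFd|exact: sFd].
    by rewrite EE' !Prod// big_fsetU1//= E'i0 muleA.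
  - by move=> _; rewrite m1E ltey_eq fin_num_measure// setTI.
by rewrite m1E m2E setIC.
Qed.

End Cylinders.

(** * Measurability of the iterates *)

Section Iterates.
Context {R : realType} {d n : nat}.
Context {disp : measure_display} {Omega : measurableType disp}.
Context {dispX : measure_display} {Xi : measurableType dispX}.
Variables (P : probability Omega R) (S : set 'rV[R]_d) (x0 : 'rV[R]_d).
Variables (eta : nat -> R) (g : 'I_n -> 'rV[R]_d -> Xi -> 'rV[R]_d).
Variables (xi : nat -> Omega -> Xi) (tau : 'I_n -> nat -> Omega -> int).
Variable x : nat -> Omega -> 'rV[R]_d.
Hypothesis sgd : delayed_projected_sgd P S x0 eta g xi tau x.

Let S0 : S !=set0. Proof. by exists x0; exact: start_in_domain sgd. Qed.

Lemma iterate_mem t w : S (x t w).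
Proof.
case: t => [|t]; first by rewrite (iterate0 sgd); exact: start_in_domain sgd.
by rewrite (iterateS sgd); apply: eproj_mem => //; exact: domain_closed sgd.
Qed.

Definition stamp i t (u : nat) : set Omega := [set w | tau i t w = u%:Z].

(** At most one indicator is nonzero, and none when the stamp is negative. The form with a general
    module serves vectors, squared norms and constants alike. *)
Lemma stamped_sum i t w (V : lmodType R) (F : nat -> V) :
  (if tau i t w is Posz s then F s else 0) =
  \sum_(u < t.+1) \1_(stamp i t u) w *: F u.
Proof.
have := stamp_range sgd i t w.
case E : (tau i t w) => [s|s] => [/andP[_]|_]; last first.
  rewrite big1 // => u _; rewrite indicE; case: (boolP (w \in _)) => [|_].
    by rewrite inE /stamp/= E.
  by rewrite scale0r.
rewrite lez_nat -ltnS => st; rewrite (bigD1 (Ordinal st))//= big1.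
  by rewrite indicE mem_set ?scale1r ?addr0.
move=> u us; rewrite indicE; case: (boolP (w \in _)) => [|_]; last by rewrite scale0r.
rewrite inE /stamp/= E => -[su]; case/eqP: us; exact/val_inj.
Qed.

Lemma aggregate_sum t w : aggregate g xi tau x t w =
  \sum_(i < n) \sum_(u < t.+1) \1_(stamp i t u) w *: estimate g xi x i u w.
Proof. by apply: eq_bigr => i _; exact: (@stamped_sum i t w _ (fun s => estimate g xi x i s w)). Qed.

Section Factor.
Context {dispT : measure_display} {T : measurableType dispT}.
Variable phi : T -> Omega.

(** [phi] will be the identity of [Omega], with a source that carries either the given sigma-algebra
    or the one generated by a history. Since [g] is measurable only over [S], the proof uses that
    iterates stay in the closed set [S]. *)
Lemma estimate_measurable i s : rv_measurable (x s \o phi) ->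
  measurable_fun setT (xi s \o phi) -> rv_measurable (estimate g xi x i s \o phi).
Proof.
move=> mx mxi.
have mS : measurable (S `*` setT : set (borel_rV R d * Xi)).
  apply: measurableX => //; rewrite -(setCK S); apply: measurableC.
  by apply: sub_sigma_algebra; exact/closed_openC/(domain_closed sgd).
have := @measurable_comp _ _ _ T (borel_rV R d * Xi)%type (borel_rV R d)
  (S `*` setT) (fun p => g i p.1 p.2) setT (fun w => (x s (phi w), xi s (phi w))) mS.
apply.
- by move=> _ [w _ <-]; split => //=; exact: iterate_mem.
- exact: estimator_measurable sgd i.
- exact: measurable_fun_pair.
Qed.

(** Only stamps from before time [t] are assumed measurable: this strictness is what makes x(t)
    independent of the delays at time [t]. The induction is strong because the aggregate may use any
    earlier iterate. *)
Lemma iterate_measurable t : (forall s, measurable_fun setT (xi s \o phi)) ->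
  (forall i s, (s < t)%N -> measurable_fun setT (tau i s \o phi)) ->
  rv_measurable (x t \o phi).
Proof.
move=> mxi; elim/ltn_ind: t => -[|t] IH mtau.
  rewrite (_ : x 0%N \o phi = cst x0); first exact: rv_measurable_cst.
  by apply/funext => w; exact: iterate0 sgd _.
have mx s : (s <= t)%N -> rv_measurable (x s \o phi).
  move=> st; apply: IH => // i r rs; apply: mtau.
  exact: leq_trans (leq_trans rs st) (leqnSn t).
rewrite (_ : x t.+1 \o phi = fun w => eproj S
    (x t (phi w) - eta t *: aggregate g xi tau x t (phi w))); last first.
  by apply/funext => w; exact: iterateS sgd _ _.
apply: continuous_rv_measurable.
  by apply: eproj_continuous => //; [exact: domain_closed sgd|exact: domain_convex sgd].
apply: rv_measurableB; first exact: mx.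
apply: rv_measurableZ; under eq_fun do rewrite aggregate_sum.
apply: rv_measurable_sum => i; apply: rv_measurable_sum => u.
have /rv_measurableP me := estimate_measurable i (mx u (ltn_ord u)) (mxi u).
apply/rv_measurableP => j; under eq_fun do rewrite mxE.
apply: measurable_funM; last exact: me.
rewrite (_ : (fun w => _) = \1_(phi @^-1` stamp i t u))//.
apply: measurable_indic; rewrite -[X in measurable X]setTI.
by apply: (mtau i t (leqnn _) measurableT [set u%:Z]).
Qed.

End Factor.

Lemma iterate_rv_measurable t : rv_measurable (x t).
Proof.
apply: (@iterate_measurable _ _ id); first exact: noise_measurable sgd.
by move=> i s _; exact: stamp_measurable sgd i s.
Qed.

Lemma estimate_rv_measurable i t : rv_measurable (estimate g xi x i t).
Proof.
apply: (@estimate_measurable _ _ id); last exact: noise_measurable sgd t.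
exact: iterate_rv_measurable.
Qed.

Lemma stamp_event_measurable i t u : measurable (stamp i t u).
Proof.
rewrite -[X in measurable X]setTI.
by apply: (stamp_measurable sgd i t measurableT (Y := [set u%:Z])).
Qed.

Hypothesis delays_indep :
  mutually_indep P (fun it => g_sigma_algebra_preimage (delay tau it)).

(* The sigma-algebra of the whole noise and of the delays before time t: it makes
   x t and all estimates up to time t measurable, and is independent of the delays
   at time t. *)
Local Notation history t :=
  (g_sigma_algebraType (cylinder (delay tau) xi [set it : 'I_n * nat | (it.2 < t)%N])).

Definition history_measurable t (Z : Omega -> R) :=
  measurable_fun setT (Z : history t -> R).

Let mdelay it : measurable_fun setT (delay tau it).
Proof.
case: it => i t _ Y _.
rewrite (_ : _ `&` _ = setT `&` tau i t @^-1` [set k | Y (t%:Z - k)])//.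
exact: (stamp_measurable sgd i t).
Qed.

Let to_history t : measurable_fun setT (id : Omega -> history t).
Proof.
move=> _ Y mY; rewrite setTI preimage_id.
apply: (smallest_sub (sigma_algebra_measurable Omega)) mY.
by apply: cylinder_measurable => //; exact: noise_measurable sgd.
Qed.

Let history_noise t s : measurable_fun setT (xi s : history t -> Xi).
Proof.
move=> _ Y mY; apply: sub_sigma_algebra.
have h : g_sigma_algebra_preimage (xi s) (setT `&` xi s @^-1` Y) by exists Y.
exact: cylinder_xi h.
Qed.

Lemma iterate_history s t : (s <= t)%N -> rv_measurable (x s : history t -> 'rV[R]_d).
Proof.
move=> st; apply: (@iterate_measurable _ (history t) id); first exact: history_noise.
move=> i r rs _ Y mY; apply: sub_sigma_algebra.
have h : g_sigma_algebra_preimage (delay tau (i, r)) (setT `&` tau i r @^-1` Y); last first.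
  by apply: cylinder_delta h; exact: leq_trans rs st.
(* Stamp and delay at time [r] determine each other through k -> r - k, so every stamp event is a
   delay event. *)
exists [set k | Y (r%:Z - k)] => //.
by rewrite !setTI; apply/seteqP; split => w /=; rewrite /delay/= opprB addrC subrK.
Qed.

Lemma estimate_history i s t : (s <= t)%N ->
  rv_measurable (estimate g xi x i s : history t -> 'rV[R]_d).
Proof.
move=> st; apply: (@estimate_measurable _ (history t) id); last exact: history_noise.
exact: iterate_history.
Qed.

Lemma mean_stampM i t u Z : history_measurable t Z -> rintegrable P Z ->
  mean P (fun w => \1_(stamp i t u) w * Z w) = fine (P (stamp i t u)) * mean P Z.
Proof.
move=> mZ iZ; have := @mean_indep _ _ _ P _ _ _ (@to_history t) (stamp i t u) Z; apply => //.
  exact: stamp_event_measurable.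
move=> B mB; rewrite preimage_id.
have := @indep_cylinders _ _ _ P _ _ _ _ _ _ (delay tau) xi mdelay
  (noise_measurable sgd) delays_indep (delay_noise_indep sgd)
  [set it : 'I_n * nat | (it.2 < t)%N] (i, t); apply => //=; first by rewrite ltnn.
exists [set (t%:Z - u%:Z)] => //; rewrite setTI; apply/seteqP; split => w /=.
  by rewrite /delay/= => /addrI/oppr_inj.
by rewrite /stamp /delay/= => ->.
Qed.

End Iterates.

(** * Moment bounds *)

(** Twice the difference of the two sides is the double sum of (b i - b j)^2. *)
Lemma sqr_sum_le (R : realFieldType) (n : nat) (b : 'I_n -> R) :
  (\sum_i b i) ^+ 2 <= n%:R * \sum_i b i ^+ 2.
Proof.
have : 0 <= \sum_(i < n) \sum_(j < n) (b i - b j) ^+ 2.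
  by apply: sumr_ge0 => i _; apply: sumr_ge0 => j _; exact: sqr_ge0.
have -> : \sum_(i < n) \sum_(j < n) (b i - b j) ^+ 2 =
    2 * (n%:R * \sum_(i < n) b i ^+ 2) - 2 * (\sum_i b i) ^+ 2.
  transitivity (\sum_(i < n) (n%:R * b i ^+ 2 - 2 * b i * (\sum_j b j) + \sum_j b j ^+ 2)).
    apply: eq_bigr => i _; rewrite -[in n%:R * _](card_ord n) mulr_natl -sumr_const.
    rewrite mulr_sumr -sumrB -big_split/=; apply: eq_bigr => j _; ring.
  rewrite big_split/= sumrB -mulr_sumr -mulr_suml -mulr_sumr sumr_const card_ord.
  by rewrite -mulr_natl; ring.
by rewrite subr_ge0 ler_pM2l.
Qed.

Section Moments.
Context {R : realType} {d n : nat}.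
Context {disp : measure_display} {Omega : measurableType disp}.
Context {dispX : measure_display} {Xi : measurableType dispX}.
Variables (P : probability Omega R) (S : set 'rV[R]_d) (x0 : 'rV[R]_d).
Variables (gfi : 'I_n -> 'rV[R]_d -> 'rV[R]_d) (L G : R) (q : nat -> R).
Variables (eta : nat -> R) (g : 'I_n -> 'rV[R]_d -> Xi -> 'rV[R]_d).
Variables (xi : nat -> Omega -> Xi) (tau : 'I_n -> nat -> Omega -> int).
Variables (x : nat -> Omega -> 'rV[R]_d) (gtilde : 'I_n -> nat -> Omega -> 'rV[R]_d).
Variables (xstar : 'rV[R]_d) (Rb : R).
Hypothesis sgd : delayed_projected_sgd P S x0 eta g xi tau x.
Hypothesis smooth : forall i y z, S y -> S z ->
  enorm (gfi i y - gfi i z) <= L * enorm (y - z).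
Hypothesis est : estimator_assumption P gfi g xi x gtilde L G q.
Hypothesis xstar_mem : S xstar.
Hypothesis dist_bound :
  forall t, ('E_P[fun w => (enorm (x t w - xstar) ^+ 2)%R] <= Rb%:E)%E.

Let S0 : S !=set0. Proof. by exists xstar. Qed.
Let Scl := domain_closed sgd.
Let Sco := domain_convex sgd.

Lemma iterate_dist_L2 t : rv_L2 P (fun w => x t w - xstar).
Proof.
have mX : rv_measurable (fun w => x t w - xstar).
  by apply: rv_measurableB; [exact: iterate_rv_measurable sgd t|exact: rv_measurable_cst].
split=> //; apply: (@expectation_le_rintegrable _ _ _ P _ Rb _ _ _).1 => //.
- by apply: measurable_funX; exact: measurable_enorm.
- by move=> w; exact: sqr_ge0.
Qed.

Lemma iterate_dist_le t : mean P (fun w => enorm (x t w - xstar) ^+ 2) <= Rb.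
Proof.
have [mX _] := iterate_dist_L2 t.
apply: (@expectation_le_rintegrable _ _ _ P _ Rb _ _ _).2 => //.
- by apply: measurable_funX; exact: measurable_enorm.
- by move=> w; exact: sqr_ge0.
Qed.

Lemma estimate_L2 i t : rv_L2 P (estimate g xi x i t).
Proof.
have [V [[iE _ _ _] _]] := second_moment est i t.
by split => //; exact: estimate_rv_measurable sgd i t.
Qed.

Lemma estimate_moment_le i t :
  mean P (fun w => enorm (estimate g xi x i t w) ^+ 2) <= G.
Proof.
have [V [[iE iV _ EV] VG]] := second_moment est i t.
rewrite -(mean_cst P G).
have -> : mean P (fun w => enorm (estimate g xi x i t w) ^+ 2) = mean P V.
  (* The conditional expectation is tested on the sure event. *)
  congr fine; apply/esym/EV; exists setT; first exact: measurableT.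
  by rewrite setTI preimage_setT.
by apply: mean_ae_le => //; exact: rintegrable_cst.
Qed.

(** A bound uniform in the agent. The individual gradients need not vanish at [xstar], which
    minimizes only their sum, and only over [S]. *)
Definition grad_bound : R := \sum_(i < n) enorm (gfi i xstar).

Lemma gradient_lipschitz i y z : S y -> S z ->
  enorm (gfi i y - gfi i z) <= `|L| * enorm (y - z).
Proof.
move=> Sy Sz; apply: le_trans (smooth i Sy Sz) _.
by rewrite ler_wpM2r ?enorm_ge0 ?ler_norm.
Qed.

Lemma gradient_le i y : S y ->
  enorm (gfi i y) <= grad_bound + `|L| * enorm (y - xstar).
Proof.
move=> Sy; rewrite -(subrK (gfi i xstar) (gfi i y)).
apply: le_trans (enormD _ _) _; rewrite addrC lerD ?gradient_lipschitz//.
by rewrite /grad_bound (bigD1 i)//= lerDl sumr_ge0// => j _; exact: enorm_ge0.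
Qed.

Lemma gradient_sqr_le i t w : enorm (gfi i (x t w)) ^+ 2 <=
  2 * grad_bound ^+ 2 + 2 * L ^+ 2 * enorm (x t w - xstar) ^+ 2.
Proof.
have := gradient_le i (iterate_mem sgd t w).
rewrite -[L ^+ 2]real_normK ?num_real//.
move: (enorm_ge0 (gfi i (x t w))) (enorm_ge0 (x t w - xstar)) (normr_ge0 L).
move: (enorm (gfi i _)) (enorm (x t w - _)) `|L| grad_bound => a b l c a0 b0 l0 h.
have h2 : a ^+ 2 <= (c + l * b) ^+ 2.
  by rewrite ler_pXn2r ?nnegrE// (le_trans a0).
apply: le_trans h2 _; have := sqr_ge0 (c - l * b).
by rewrite -mulrA -exprMn; move: (l * b) => e; rewrite sqrrB sqrrD; lra.
Qed.

Lemma gradient_L2 i t : rv_L2 P (fun w => gfi i (x t w)).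
Proof.
have mG : rv_measurable (fun w => gfi i (x t w)).
  (* [gfi i] is Lipschitz only on [S]; after the nonexpansive projection it is Lipschitz everywhere,
     hence Borel. *)
  rewrite (_ : (fun w => _) = fun w => (gfi i \o eproj S) (x t w)); last first.
    apply/funext => w /=; rewrite eproj_id//; exact: iterate_mem sgd t w.
  apply: continuous_rv_measurable; last exact: iterate_rv_measurable sgd t.
  apply: (@elipschitz_continuous _ _ _ `|L|) => y z /=.
  apply: le_trans (gradient_lipschitz _ _ _) _; try exact: eproj_mem.
  by rewrite ler_wpM2l//; exact: eproj_nonexpansive.
have [_ iD] := iterate_dist_L2 t.
apply: rv_L2_le mG _ (gradient_sqr_le i t).
apply: rintegrableD; first exact: (rintegrable_cst P (2 * grad_bound ^+ 2)).
exact: rintegrableZ.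
Qed.

Lemma gradient_moment_le i t : mean P (fun w => enorm (gfi i (x t w)) ^+ 2) <=
  2 * grad_bound ^+ 2 + 2 * L ^+ 2 * Rb.
Proof.
have [_ iG] := gradient_L2 i t; have [_ iD] := iterate_dist_L2 t.
apply: le_trans (mean_le iG _ (gradient_sqr_le i t)) _.
  apply: rintegrableD; first exact: (rintegrable_cst P (2 * grad_bound ^+ 2)).
  exact: rintegrableZ.
rewrite meanD; [|exact: (rintegrable_cst P (2 * grad_bound ^+ 2))|exact: rintegrableZ].
rewrite (mean_cst P) meanZ// lerD2l ler_wpM2l ?iterate_dist_le//.
by rewrite mulr_ge0 ?sqr_ge0.
Qed.

(** Almost surely [gtilde i t] is within the constant [q t] of a square-integrable gradient. *)
Lemma gtilde_L2 i t : rv_L2 P (gtilde i t).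
Proof.
have mg : rv_measurable (gtilde i t).
  apply/rv_measurableP => j; have [_ + _ _] := gtilde_cond_expectation est i t j.
  exact: rintegrable_measurable.
split=> //; have [_ iG] := gradient_L2 i t.
apply: (@rintegrable_ae_le _ _ _ P _
  (fun w => 2 * q t ^+ 2 + 2 * enorm (gfi i (x t w)) ^+ 2)).
- by apply: measurable_funX; exact: measurable_enorm.
- apply: rintegrableD; first exact: (rintegrable_cst P (2 * q t ^+ 2)).
  exact: rintegrableZ.
- apply: filterS (bias_bound est i t) => w h; rewrite ger0_norm ?sqr_ge0//.
  have h1 : enorm (gtilde i t w) <= q t + enorm (gfi i (x t w)).
    rewrite -[X in enorm X](subrK (gfi i (x t w))).
    by apply: le_trans (enormD _ _) _; rewrite lerD2r.
  move: (enorm_ge0 (gtilde i t w)) h1.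
  move: (enorm (gtilde i t w)) (enorm (gfi i (x t w))) (q t) => a b c a0 h1.
  have h2 : a ^+ 2 <= (c + b) ^+ 2 by rewrite ler_pXn2r ?nnegrE// (le_trans a0).
  apply: le_trans h2 _; have := sqr_ge0 (c - b).
  by rewrite sqrrB sqrrD; lra.
Qed.

Lemma mean_estimate_gtilde i u :
  mean P (fun w => dotr (estimate g xi x i u w) (x u w - xstar)) =
  mean P (fun w => dotr (gtilde i u w) (x u w - xstar)).
Proof.
rewrite !mean_sum; first last.
- by move=> j; apply: rv_L2_coordM; [exact: estimate_L2|exact: iterate_dist_L2].
- by move=> j; apply: rv_L2_coordM; [exact: gtilde_L2|exact: iterate_dist_L2].
apply: eq_bigr => j _.
apply: (@mean_cond_expectation _ _ _ P _ _ (x u : Omega -> borel_rV R d) _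
  (fun w => estimate g xi x i u w 0 j) (fun w => gtilde i u w 0 j)
  (fun y => (y - xstar : 'rV[R]_d) 0 j)).
- exact: iterate_rv_measurable sgd u.
- exact: gtilde_cond_expectation est i u j.
- apply: (@continuous_measurable_rV_real _ _ (fun y : 'rV[R]_d => (y - xstar) 0 j)).
  rewrite (_ : (fun y : 'rV[R]_d => _) = fun y => y 0 j - xstar 0 j); last first.
    by apply/funext => y; rewrite !mxE.
  by move=> y; apply: (@cvgB R R^o _ (nbhs y) _ (fun y : 'rV[R]_d => y 0 j) (cst (xstar 0 j)));
    [exact: coord_continuous|exact: cvg_cst].
- by apply: rv_L2_coordM; [exact: estimate_L2|exact: iterate_dist_L2].
- by apply: rv_L2_coordM; [exact: gtilde_L2|exact: iterate_dist_L2].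
Qed.

Hypothesis delays_indep :
  mutually_indep P (fun it => g_sigma_algebra_preimage (delay tau it)).

Lemma mean_stamp i t u : mean P (\1_(stamp tau i t u)) = fine (P (stamp tau i t u)).
Proof.
rewrite /mean /Rintegral integral_indic//; last exact: stamp_event_measurable sgd i t u.
by rewrite setIT.
Qed.

Lemma rintegrable_stamp i t u : rintegrable P (\1_(stamp tau i t u)).
Proof. by apply: integrable_indic; exact: stamp_event_measurable sgd i t u. Qed.

Lemma sum_stamp_le1 i t : \sum_(u < t.+1) fine (P (stamp tau i t u)) <= 1.
Proof.
rewrite (eq_bigr (fun u : 'I__ => mean P (\1_(stamp tau i t u)))); last first.
  by move=> u _; rewrite mean_stamp.
rewrite -mean_sum; last by move=> u; exact: rintegrable_stamp.
rewrite -[leRHS](mean_cst P); apply: mean_le.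
- by apply: rintegrable_sum => u; exact: rintegrable_stamp.
- exact: rintegrable_cst.
move=> w; have /= := @stamped_sum _ _ _ _ _ _ _ _ _ _ _ _ _ _ _ sgd i t w R^o (fun=> 1).
under eq_bigr do rewrite /GRing.scale/= mulr1.
by move=> <-; case: (tau i t w).
Qed.

Lemma stamped_estimate_L2 i t u :
  rv_L2 P (fun w => \1_(stamp tau i t u) w *: estimate g xi x i u w).
Proof.
have [mE iE] := estimate_L2 i u.
apply: rv_L2_le iE _.
  move/rv_measurableP : mE => mE; apply/rv_measurableP => j.
  under eq_fun do rewrite mxE; apply: measurable_funM => //.
  by apply: measurable_indic; exact: stamp_event_measurable sgd i t u.
move=> w; rewrite enormZ exprMn ler_piMl ?sqr_ge0// indicE.
by case: (_ \in _) => /=; rewrite ?normr1 ?normr0 ?expr1n ?expr0n.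
Qed.

Lemma aggregate_L2 t : rv_L2 P (aggregate g xi tau x t).
Proof.
rewrite (_ : aggregate g xi tau x t = fun w => \sum_(i < n) \sum_(u < t.+1)
  \1_(stamp tau i t u) w *: estimate g xi x i u w); last first.
  by apply/funext => w; exact: aggregate_sum sgd t w.
by apply: rv_L2_sum => i; apply: rv_L2_sum => u; exact: stamped_estimate_L2.
Qed.

Lemma aggregate_sqr_le t w : enorm (aggregate g xi tau x t w) ^+ 2 <=
  n%:R * \sum_(i < n) \sum_(u < t.+1)
    \1_(stamp tau i t u) w * enorm (estimate g xi x i u w) ^+ 2.
Proof.
pose a i := (if tau i t w is Posz s then estimate g xi x i s w else 0).
rewrite (eq_bigr (fun i => enorm (a i) ^+ 2)); last first.
  move=> i _; have /= := @stamped_sum _ _ _ _ _ _ _ _ _ _ _ _ _ _ _ sgd i t w R^o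
    (fun u => enorm (estimate g xi x i u w) ^+ 2).
  rewrite /GRing.scale/= => <-; rewrite /a.
  by case: (tau i t w) => // _; rewrite enorm0 expr0n.
rewrite /aggregate -/(a _).
have h : enorm (\sum_i a i) ^+ 2 <= (\sum_i enorm (a i)) ^+ 2.
  by rewrite ler_pXn2r ?nnegrE ?enorm_ge0 ?sumr_ge0 ?enorm_sum// => i _; exact: enorm_ge0.
apply: le_trans h _.
exact: sqr_sum_le.
Qed.

(** By independence, stamp [u] contributes its probability times at most [G], and these
    probabilities add up to at most 1, however many stamps are possible. One factor n comes from
    [sqr_sum_le], the other from the sum over agents. *)
Lemma aggregate_moment_le t :
  mean P (fun w => enorm (aggregate g xi tau x t w) ^+ 2) <= n%:R ^+ 2 * G.
Proof.
have iE i (u : 'I_t.+1) : rintegrable P (fun w =>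
    \1_(stamp tau i t u) w * enorm (estimate g xi x i u w) ^+ 2).
  apply: rintegrable_indicM; first exact: stamp_event_measurable sgd i t u.
  by case: (estimate_L2 i u).
have [_ iA] := aggregate_L2 t.
apply: le_trans (mean_le iA _ (aggregate_sqr_le t)) _.
  by apply: rintegrableZ; apply: rintegrable_sum => i; apply: rintegrable_sum.
rewrite meanZ ?expr2 -?mulrA ?ler_wpM2l//; last first.
  by apply: rintegrable_sum => i; apply: rintegrable_sum.
rewrite mean_sum; last by move=> i; exact: rintegrable_sum.
rewrite -[X in X%:R * G](card_ord n) mulr_natl -sumr_const ler_sum// => i _.
rewrite mean_sum//; apply: (@le_trans _ _ (\sum_(u < t.+1) fine (P (stamp tau i t u)) * G)).
  apply: ler_sum => u _.
  rewrite (mean_stampM sgd delays_indep).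
  - rewrite ler_wpM2l ?estimate_moment_le//; exact: fine_ge0.
  - apply: measurable_funX; apply: measurable_enorm; apply: estimate_history sgd _ _ _ _.
    by rewrite -ltnS.
  - by case: (estimate_L2 i u).
rewrite -mulr_suml ler_piMl ?sum_stamp_le1//; exact: ltW (second_moment_gt0 est).
Qed.

(** * The error caused by a stale gradient *)

Lemma drift_le u t w : (u <= t)%N -> enorm (x t w - x u w) <=
  \sum_(u <= s < t) eta s * enorm (aggregate g xi tau x s w).
Proof.
elim: t => [|t IH]; first by rewrite leqn0 => /eqP ->; rewrite big_geq// subrr enorm0.
rewrite leq_eqVlt => /predU1P[->|]; first by rewrite big_geq// subrr enorm0.
rewrite ltnS => ut; rewrite big_nat_recr//= -(subrK (x t w) (x t.+1 w)) -addrA addrC.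
apply: le_trans (enormD _ _) _; apply: lerD; first exact: IH.
(* The iterate is fixed by the projection, so nonexpansiveness bounds one move by the length of the
   unprojected step. *)
have -> : x t.+1 w - x t w =
    eproj S (x t w - eta t *: aggregate g xi tau x t w) - eproj S (x t w).
  by rewrite (iterateS sgd) [eproj S (x t w)]eproj_id//; exact: iterate_mem sgd t w.
apply: le_trans (eproj_nonexpansive Scl S0 Sco _ _) _.
by rewrite addrAC subrr add0r enormN enormZ gtr0_norm// (stepsize_gt0 sgd).
Qed.

(** The division by 2 is Young's. The aggregate has second moment at most n^2 G; the 3 comes from
    squaring the three terms of [spread], whose second moments are at most G, L^2 Rb and 2
    grad_bound^2 + 2 L^2 Rb. *)
Definition stale_const : R :=
  (n%:R ^+ 2 * G + 3 * (G + 3 * L ^+ 2 * Rb + 2 * grad_bound ^+ 2)) / 2.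

(** The total factor that multiplies the drift |x t - x u| in the error of a stale gradient. *)
Let spread i u t w : R :=
  enorm (estimate g xi x i u w) + `|L| * enorm (x u w - xstar) + enorm (gfi i (x t w)).

Let spread_sqr_le i u t w : spread i u t w ^+ 2 <=
  3 * (enorm (estimate g xi x i u w) ^+ 2 + L ^+ 2 * enorm (x u w - xstar) ^+ 2 +
       enorm (gfi i (x t w)) ^+ 2).
Proof.
rewrite /spread -[L ^+ 2]real_normK ?num_real// -exprMn.
move: (enorm _) (`|L| * _) (enorm _) => a b c.
have h1 := sqr_ge0 (a - b); have h2 := sqr_ge0 (a - c); have h3 := sqr_ge0 (b - c).
(* 3 (a^2 + b^2 + c^2) - (a + b + c)^2 is the sum of the three squared differences. *)
by rewrite -subr_ge0 (_ : _ - _ = (a - b) ^+ 2 + (a - c) ^+ 2 + (b - c) ^+ 2); [lra|ring].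
Qed.

Let young (a b : R) : a * b <= (a ^+ 2 + b ^+ 2) / 2.
Proof. by have := sqr_ge0 (a - b); rewrite sqrrB; lra. Qed.

(** The bracketed difference is not small pointwise but has mean zero by [mean_estimate_gtilde], so
    it stays on the left. Everything else is at most the drift times [spread], plus a bias term. *)
Let stale_pointwise i u t : (u <= t)%N -> {ae P, forall w,
  dotr (gfi i (x t w)) (x t w - xstar)
    + (dotr (estimate g xi x i u w) (x u w - xstar) - dotr (gtilde i u w) (x u w - xstar))
    - dotr (estimate g xi x i u w) (x t w - xstar) <=
  \sum_(u <= s < t) (eta s / 2 * (enorm (aggregate g xi tau x s w) ^+ 2 + 3 *
      (enorm (estimate g xi x i u w) ^+ 2 + L ^+ 2 * enorm (x u w - xstar) ^+ 2 +
       enorm (gfi i (x t w)) ^+ 2)))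
  + q t / 2 * (1 + enorm (x u w - xstar) ^+ 2)}.
Proof.
move=> ut; have := gtilde_lipschitz est i u t; have := bias_bound est i t.
apply: filterS2 => w hb hl.
set e := estimate g xi x i u w in hb hl *; set gu := gtilde i u w in hb hl *.
set gt := gtilde i t w in hb hl *; set gr := gfi i (x t w) in hb hl *.
set xt := x t w in hb hl *; set xu := x u w in hb hl *.
(* [gu] is moved to [gt] before the comparison with the gradient, so that the bias appears as [q t]
   and not as [q u]. *)
have -> : dotr gr (xt - xstar) + (dotr e (xu - xstar) - dotr gu (xu - xstar))
    - dotr e (xt - xstar) =
  dotr (gt - gu) (xu - xstar) + dotr (gr - gt) (xu - xstar)
  + dotr gr (xt - xu) + dotr e (xu - xt).
  by rewrite !dotrE; ring.
have h1 : dotr (gt - gu) (xu - xstar) <= enorm (xt - xu) * (`|L| * enorm (xu - xstar)).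
  apply: le_trans (dotr_le _ _) _; rewrite mulrA ler_wpM2r ?enorm_ge0//.
  rewrite enormBC mulrC (enormBC xt); apply: le_trans hl _.
  by rewrite ler_wpM2r ?enorm_ge0 ?ler_norm.
have h2 : dotr (gr - gt) (xu - xstar) <= q t * enorm (xu - xstar).
  by apply: le_trans (dotr_le _ _) _; rewrite ler_wpM2r ?enorm_ge0// enormBC.
have h3 : dotr gr (xt - xu) <= enorm (xt - xu) * enorm gr.
  by apply: le_trans (dotr_le _ _) _; rewrite mulrC.
have h4 : dotr e (xu - xt) <= enorm (xt - xu) * enorm e.
  by apply: le_trans (dotr_le _ _) _; rewrite mulrC (enormBC xu).
have h5 : enorm (xt - xu) * spread i u t w <= \sum_(u <= s < t) (eta s / 2 *
    (enorm (aggregate g xi tau x s w) ^+ 2 + 3 *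
      (enorm e ^+ 2 + L ^+ 2 * enorm (xu - xstar) ^+ 2 + enorm gr ^+ 2))).
  have sp0 : 0 <= spread i u t w.
    by rewrite /spread !addr_ge0 ?mulr_ge0 ?enorm_ge0.
  apply: le_trans (ler_wpM2r sp0 (drift_le w ut)) _.
  rewrite mulr_suml; apply: ler_sum => s _.
  rewrite -[leLHS]mulrA -[leRHS]mulrA ler_pM2l ?(stepsize_gt0 sgd)//.
  apply: le_trans (young _ _) _; rewrite mulrC ler_pM2l ?invr_gt0//.
  by rewrite lerD2l; exact: spread_sqr_le.
have h6 : q t * enorm (xu - xstar) <= q t / 2 * (1 + enorm (xu - xstar) ^+ 2).
  rewrite -mulrA ler_wpM2l ?(bias_ge0 est)//.
  have := young 1 (enorm (xu - xstar)); rewrite mul1r expr1n mulrC; exact.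
move: h5; rewrite /spread -/e -/gr -/xu !mulrDr => h5.
by move: h1 h2 h3 h4 h5 h6; lra.
Qed.

(* The estimate can be replaced by its conditional expectation only against
   x u - xstar, which is a function of x u; the Lipschitz bound on gtilde then
   moves from time u to time t, and all differences are paid for by the drift. *)
Lemma stale_gradient_le i u t : (u <= t)%N ->
  mean P (fun w => dotr (gfi i (x t w)) (x t w - xstar)) -
  mean P (fun w => dotr (estimate g xi x i u w) (x t w - xstar)) <=
  stale_const * (\sum_(u <= s < t) eta s) + q t * ((1 + Rb) / 2).
Proof.
move=> ut.
have i1 := rv_L2_dotr (gradient_L2 i t) (iterate_dist_L2 t).
have i2 := rv_L2_dotr (estimate_L2 i u) (iterate_dist_L2 u).
have i3 := rv_L2_dotr (gtilde_L2 i u) (iterate_dist_L2 u).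
have i4 := rv_L2_dotr (estimate_L2 i u) (iterate_dist_L2 t).
have [_ iE] := estimate_L2 i u.
have [_ iD] := iterate_dist_L2 u.
have [_ iG] := gradient_L2 i t.
have iA s : rintegrable P (fun w => enorm (aggregate g xi tau x s w) ^+ 2).
  by case: (aggregate_L2 s).
have i12 := rintegrableB i2 i3.
have iEDG := rintegrableD (rintegrableD iE (rintegrableZ (L ^+ 2) iD)) iG.
have iS s := rintegrableD (iA s) (rintegrableZ 3 iEDG).
have iSs s := rintegrableZ (eta s / 2) (iS s).
have iSS := rintegrable_sum (index_iota u t) iSs.
have iQ := rintegrableZ (q t / 2) (rintegrableD (rintegrable_cst P 1) iD).
have := mean_ae_le (rintegrableB (rintegrableD i1 i12) i4) (rintegrableD iSS iQ)
  (stale_pointwise i ut).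
rewrite (meanB (rintegrableD i1 i12) i4) (meanD i1 i12) (meanB i2 i3).
rewrite mean_estimate_gtilde subrr addr0 => h; apply: le_trans h _.
rewrite (meanD iSS iQ) (mean_sum _ iSs) (meanZ (q t / 2)); last first.
  exact: (rintegrableD (rintegrable_cst P 1) iD).
rewrite (meanD (rintegrable_cst P 1) iD) mean_cst; apply: lerD.
  rewrite mulr_sumr; apply: ler_sum => s _.
  rewrite (meanZ _ (iS s)) (meanD (iA s) (rintegrableZ 3 iEDG)) (meanZ _ iEDG).
  rewrite (meanD (rintegrableD iE (rintegrableZ (L ^+ 2) iD)) iG).
  rewrite (meanD iE (rintegrableZ (L ^+ 2) iD)) (meanZ _ iD).
  rewrite [leRHS]mulrC -[leLHS]mulrA ler_pM2l ?(stepsize_gt0 sgd)// /stale_const.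
  have h1 := aggregate_moment_le s; have h2 := estimate_moment_le i u.
  have h3 := gradient_moment_le i t.
  have h4 := ler_wpM2l (sqr_ge0 L) (iterate_dist_le u).
  move: h1 h2 h3 h4; move: (mean _ _) (mean _ _) (mean _ _) (L ^+ 2 * mean _ _).
  move=> m1 m2 m3 m4; rewrite -!mulrA.
  move: (_ * G) (L ^+ 2 * Rb) (grad_bound ^+ 2) => y1 y2 y3; lra.
rewrite -mulrA ler_wpM2l ?(bias_ge0 est)// mulrC ler_pM2r ?invr_gt0//.
by rewrite lerD2l iterate_dist_le.
Qed.

End Moments.

(** * Descent and averaging *)

Section Descent.
Context {R : realType} {d n : nat}.
Context {disp : measure_display} {Omega : measurableType disp}.
Context {dispX : measure_display} {Xi : measurableType dispX}.
Variables (P : probability Omega R) (S : set 'rV[R]_d) (x0 : 'rV[R]_d).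
Variables (fi : 'I_n -> 'rV[R]_d -> R) (gfi : 'I_n -> 'rV[R]_d -> 'rV[R]_d).
Variables (L G C kappa : R) (q : nat -> R).
Variables (eta : nat -> R) (g : 'I_n -> 'rV[R]_d -> Xi -> 'rV[R]_d).
Variables (xi : nat -> Omega -> Xi) (tau : 'I_n -> nat -> Omega -> int).
Variables (x : nat -> Omega -> 'rV[R]_d) (gtilde : 'I_n -> nat -> Omega -> 'rV[R]_d).
Variables (xstar : 'rV[R]_d) (Rb : R).
Hypothesis sgd : delayed_projected_sgd P S x0 eta g xi tau x.
Hypothesis obj : objective_assumption S fi gfi L.
Hypothesis est : estimator_assumption P gfi g xi x gtilde L G q.
Hypothesis del : delay_assumption P tau C kappa.
Hypothesis fconvex : @convex_function R 'rV[R]_d S (objective fi).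
Hypothesis xstar_min : argmin_on S (objective fi) xstar.
Hypothesis Rb_gt0 : 0 < Rb.
Hypothesis dist_bound :
  forall t, ('E_P[fun w => (enorm (x t w - xstar) ^+ 2)%R] <= Rb%:E)%E.

Let f := objective fi.
Let smooth := local_smooth obj.
Let xstar_mem : S xstar := xstar_min.1.
Let S0 : S !=set0. Proof. by exists xstar. Qed.
Let Scl := domain_closed sgd.
Let Sco := domain_convex sgd.
Let dist_L2 := iterate_dist_L2 sgd dist_bound.
Let grad_L2 := gradient_L2 sgd smooth xstar_mem dist_bound.
Let agg_L2 := aggregate_L2 sgd est.

Let fgrad : gradient_on S f (fun y => \sum_(i < n) gfi i y).
Proof. by apply: gradient_on_sum => i; exact: local_gradient obj i. Qed.

Lemma objective_measurable (X : Omega -> 'rV[R]_d) : rv_measurable X ->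
  (forall w, S (X w)) -> measurable_fun setT (fun w => f (X w)).
Proof.
move=> mX SX.
rewrite (_ : (fun w => _) = fun w => (f \o eproj S) (X w)); last first.
  by apply/funext => w /=; rewrite eproj_id.
apply: continuous_rv_measurable_real mX.
exact: within_continuous_eproj (gradient_on_continuous fgrad).
Qed.

Lemma objective_gap_le t w :
  f (x t w) - f xstar <= \sum_(i < n) dotr (gfi i (x t w)) (x t w - xstar).
Proof.
have Sx := iterate_mem sgd t w.
have := convex_gradient_le Sco fconvex fgrad Sx xstar_mem.
rewrite -dotr_suml -opprB dotrNr -/f.
by move: (dotr _ _) (f (x t w)) (f xstar) => a b c; lra.
Qed.

Lemma objective_rintegrable t : rintegrable P (fun w => f (x t w)).
Proof.
have iS : rintegrable P (fun w => \sum_(i < n) dotr (gfi i (x t w)) (x t w - xstar)).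
  by apply: rintegrable_sum => i; exact: rv_L2_dotr.
apply: rintegrable_le (rintegrableD (rintegrable_cst P `|f xstar|) iS) _.
  apply: objective_measurable; first exact: iterate_rv_measurable sgd t.
  exact: iterate_mem sgd t.
move=> w; rewrite -[X in `|X|](subrK (f xstar)) addrC.
apply: le_trans (ler_normD _ _) _; rewrite lerD2l ger0_norm ?objective_gap_le//.
by rewrite subr_ge0; apply: xstar_min.2; exact: iterate_mem sgd t w.
Qed.

(* Below kappa * t a stamp has probability zero; in particular the junk value 0
   for a missing report contributes nothing. *)
Let stamp_early i t u : u%:R < kappa * t%:R -> fine (P (stamp tau i t u)) = 0.
Proof.
move=> ut; rewrite -(mean_stamp sgd); apply: mean_ae_eq0; last first.
  by apply: measurable_indic; exact: stamp_event_measurable sgd i t u.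
apply: filterS (delay_linear del i t) => w; rewrite indicE.
case: (boolP (w \in _)) => //; rewrite inE /stamp/= /delay/= => -> h.
exfalso; move: h; rewrite rmorphB/= => h.
by move: ut h; rewrite -!pmulrn mulrBl mul1r; move: (kappa * _) => a; lra.
Qed.

(** A negative stamp would give a delay of at least t + 1, above the almost sure bound (1 - kappa)
    t; hence no mass is lost to missing reports. *)
Lemma sum_stamp i t : \sum_(u < t.+1) fine (P (stamp tau i t u)) = 1.
Proof.
have iu := fun u => rintegrable_stamp sgd i t u.
rewrite (eq_bigr (fun u : 'I__ => mean P (\1_(stamp tau i t u)))); last first.
  by move=> u _; rewrite (mean_stamp sgd).
have iS : rintegrable P (fun w => \sum_(u < t.+1) \1_(stamp tau i t u) w).
  by apply: rintegrable_sum => u; exact: iu.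
rewrite -mean_sum; last by move=> u; exact: iu.
apply/eqP; rewrite -subr_eq0 -[X in _ - X](mean_cst P).
rewrite -(meanB iS (rintegrable_cst P 1)); apply/eqP/mean_ae_eq0; last first.
  exact: rintegrable_measurable (rintegrableB iS (rintegrable_cst P 1)).
apply: filterS (delay_linear del i t) => w.
have /= := @stamped_sum _ _ _ _ _ _ _ _ _ _ _ _ _ _ _ sgd i t w R^o (fun=> 1).
under eq_bigr do rewrite /GRing.scale/= mulr1.
move=> <-; rewrite /delay/=; case: (tau i t w) => [s|s]; first by rewrite subrr.
move=> h; exfalso; move: h.
have /andP[k0 _] := kappa_itv del.
rewrite rmorphB/= NegzE rmorphN/= opprK -!pmulrn mulrBl mul1r.
have := mulr_ge0 (ltW k0) (ler0n R t); have := ltr0Sn R s.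
by move: (kappa * _) => a; lra.
Qed.

(** The left side is the mean delay over nonnegative stamps; a natural number is at most its square,
    so the second moment bounds it. *)
Lemma sum_stamp_delay i t :
  \sum_(u < t.+1) fine (P (stamp tau i t u)) * (t - u)%:R <= C.
Proof.
have iu u := rintegrableZ ((t - u)%:R) (rintegrable_stamp sgd i t u).
rewrite (eq_bigr (fun u : 'I__ =>
    mean P (fun w => (t - u)%:R * \1_(stamp tau i t u) w))); last first.
  by move=> u _; rewrite (meanZ _ (rintegrable_stamp sgd i t u)) (mean_stamp sgd) mulrC.
rewrite -mean_sum; last by move=> u; exact: iu.
have iS : rintegrable P (fun w => \sum_(u < t.+1) (t - u)%:R * \1_(stamp tau i t u) w).
  by apply: rintegrable_sum => u; exact: iu.
have mD : measurable_fun setT (fun w => ((delay tau (i, t) w)%:~R : R) ^+ 2).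
  move=> _ Y mY; rewrite /delay/=.
  exact: (stamp_measurable sgd i t measurableT (Y := [set k | Y ((t%:Z - k)%:~R ^+ 2)])).
have [//|iD mDC] := expectation_le_rintegrable mD _ (delay_moment del i t).
  by move=> w; exact: sqr_ge0.
apply: le_trans mDC; apply: mean_le => // w.
have /= := @stamped_sum _ _ _ _ _ _ _ _ _ _ _ _ _ _ _ sgd i t w R^o (fun u => (t - u)%:R).
under eq_bigr do rewrite /GRing.scale/= mulrC.
move=> <-; have := stamp_range sgd i t w; rewrite /delay/=.
case: (tau i t w) => [s|s] /andP[_ st]; last exact: sqr_ge0.
rewrite lez_nat in st; rewrite subzn// -pmulrn -natrX ler_nat.
by case: (t - s)%N => // k; rewrite -mulnn leq_pmulr.
Qed.

Lemma mean_aggregate_dist t :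
  mean P (fun w => dotr (aggregate g xi tau x t w) (x t w - xstar)) =
  \sum_(i < n) \sum_(u < t.+1) fine (P (stamp tau i t u)) *
    mean P (fun w => dotr (estimate g xi x i u w) (x t w - xstar)).
Proof.
have iu i u := rv_L2_dotr (estimate_L2 sgd est i u) (dist_L2 t).
have iZ i u : rintegrable P (fun w => \1_(stamp tau i t u) w *
    dotr (estimate g xi x i u w) (x t w - xstar)).
  by apply: rintegrable_indicM => //; exact: stamp_event_measurable sgd i t u.
transitivity (mean P (fun w => \sum_(i < n) \sum_(u < t.+1) \1_(stamp tau i t u) w *
    dotr (estimate g xi x i u w) (x t w - xstar))).
  congr (mean P _); apply/funext => w; rewrite (aggregate_sum sgd) dotr_suml.
  apply: eq_bigr => i _; rewrite dotr_suml; apply: eq_bigr => u _.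
  by rewrite dotrZl.
rewrite mean_sum; last by move=> i; apply: rintegrable_sum => u.
apply: eq_bigr => i _; rewrite mean_sum//; apply: eq_bigr => u _.
rewrite (mean_stampM sgd (delay_indep del))//.
apply: measurable_dotr; first by apply: (estimate_history sgd); rewrite -ltnS.
by apply: rv_measurableB; [exact: iterate_history sgd _ _ _|exact: rv_measurable_cst].
Qed.

Variable M : R.
Hypothesis stepsize_ratio : forall t s : nat, kappa * t%:R <= s%:R -> eta s <= M * eta t.

Let K := stale_const gfi L G xstar Rb.

Let K_ge0 : 0 <= K.
Proof.
have G0 := ltW (second_moment_gt0 est).
apply: divr_ge0 => //; apply: addr_ge0; first exact: mulr_ge0 (sqr_ge0 _) G0.
have h1 := mulr_ge0 (sqr_ge0 L) (ltW Rb_gt0); have h2 := sqr_ge0 (grad_bound gfi xstar).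
by move: h1 h2; rewrite -mulrA; move: (L ^+ 2 * Rb) (_ ^+ 2) => a b; lra.
Qed.

Let Meta_ge0 t : 0 <= M * eta t.
Proof.
have := stepsize_gt0 sgd t; have : eta t <= M * eta t.
  apply: stepsize_ratio; have /andP[_ k1] := kappa_itv del.
  by rewrite ler_piMl ?ler0n// ltW.
by lra.
Qed.

(** Either the stamp is earlier than kappa t and has probability zero, or each of the t - u step
    sizes in the sum is at most M eta(t). *)
Let stale_weight i t (u : 'I_t.+1) :
  fine (P (stamp tau i t u)) * (\sum_(u <= s < t) eta s) <=
  fine (P (stamp tau i t u)) * (t - u)%:R * (M * eta t).
Proof.
have [/stamp_early ->|ut] := ltP u%:R (kappa * t%:R); first by rewrite !mul0r.
rewrite -mulrA ler_wpM2l ?fine_ge0//.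
rewrite mulr_natl -sumr_const_nat; apply: ler_sum_nat => s /andP[us _].
by apply: stepsize_ratio; apply: le_trans ut _; rewrite ler_nat.
Qed.

Lemma stale_agent_le i t :
  mean P (fun w => dotr (gfi i (x t w)) (x t w - xstar)) -
  \sum_(u < t.+1) fine (P (stamp tau i t u)) *
    mean P (fun w => dotr (estimate g xi x i u w) (x t w - xstar)) <=
  K * (C * (M * eta t)) + q t * ((1 + Rb) / 2).
Proof.
set m := mean P _.
(* The stamp probabilities sum to 1, so the current gradient can be compared with the estimates
   stamp by stamp. *)
have -> : m = \sum_(u < t.+1) fine (P (stamp tau i t u)) * m.
  by rewrite -mulr_suml sum_stamp mul1r.
rewrite -sumrB.
apply: (@le_trans _ _ (\sum_(u < t.+1) (K * (fine (P (stamp tau i t u)) * (t - u)%:R *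
    (M * eta t)) + fine (P (stamp tau i t u)) * (q t * ((1 + Rb) / 2))))).
  apply: ler_sum => u _; rewrite -mulrBr.
  have ut : (u <= t)%N by rewrite -ltnS.
  have p0 : 0 <= fine (P (stamp tau i t u)) by exact: fine_ge0.
  have := stale_gradient_le sgd smooth est xstar_mem dist_bound (delay_indep del) i ut.
  rewrite -/K -/m => /(ler_wpM2l p0)/le_trans; apply.
  rewrite mulrDr lerD2r mulrCA ler_wpM2l//; exact: stale_weight.
rewrite big_split/= -mulr_sumr -!mulr_suml sum_stamp mul1r lerD2r.
rewrite ler_wpM2l// ler_wpM2r//; exact: sum_stamp_delay.
Qed.

Definition gap_at t : R := mean P (fun w => f (x t w)) - f xstar.

Lemma gap_at_le t : gap_at t <=
  mean P (fun w => dotr (aggregate g xi tau x t w) (x t w - xstar)) +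
  n%:R * (K * (C * (M * eta t)) + q t * ((1 + Rb) / 2)).
Proof.
have iG i := rv_L2_dotr (grad_L2 i t) (dist_L2 t).
apply: (@le_trans _ _ (\sum_(i < n) mean P (fun w => dotr (gfi i (x t w)) (x t w - xstar)))).
  rewrite -mean_sum// /gap_at -[X in _ - X <= _](mean_cst P).
  have ifx := objective_rintegrable t.
  rewrite -(meanB ifx (rintegrable_cst P _)); apply: mean_le.
  - exact: rintegrableB ifx (rintegrable_cst P _).
  - exact: rintegrable_sum.
  - exact: objective_gap_le.
rewrite mean_aggregate_dist addrC -lerBlDr -sumrB.
rewrite -[X in X%:R * _](card_ord n) mulr_natl -sumr_const.
by apply: ler_sum => i _; exact: stale_agent_le.
Qed.

(** Coefficient of eta(t)^2: the squared step gives n^2 G, and the stale error K C M eta(t) of each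
    of the n agents is multiplied by 2 eta(t). *)
Definition step_const : R := n%:R ^+ 2 * G + 2 * n%:R * (K * C * M).

Lemma descent t : 2 * eta t * gap_at t <=
  mean P (fun w => enorm (x t w - xstar) ^+ 2) -
  mean P (fun w => enorm (x t.+1 w - xstar) ^+ 2) +
  (step_const * eta t ^+ 2 + n%:R * (1 + Rb) * (eta t * q t)).
Proof.
have e0 := stepsize_gt0 sgd t.
have [_ i0] := dist_L2 t; have [_ i1] := dist_L2 t.+1; have [_ iA] := agg_L2 t.
have iAd := rv_L2_dotr (agg_L2 t) (dist_L2 t).
have i01 := rintegrableD i0 (rintegrableZ (- (2 * eta t)) iAd).
have iall := rintegrableD i01 (rintegrableZ (eta t ^+ 2) iA).
have : mean P (fun w => enorm (x t.+1 w - xstar) ^+ 2) <=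
    mean P (fun w => enorm (x t w - xstar) ^+ 2) +
    - (2 * eta t) * mean P (fun w => dotr (aggregate g xi tau x t w) (x t w - xstar)) +
    eta t ^+ 2 * mean P (fun w => enorm (aggregate g xi tau x t w) ^+ 2).
  rewrite -(meanZ _ iA) -(meanZ _ iAd) -(meanD i0 (rintegrableZ _ iAd)).
  rewrite -(meanD i01 (rintegrableZ _ iA)); apply: mean_le => // w.
  rewrite (iterateS sgd).
  have h : enorm (eproj S (x t w - eta t *: aggregate g xi tau x t w) - xstar) <=
      enorm ((x t w - xstar) - eta t *: aggregate g xi tau x t w).
    rewrite -{1}(eproj_id Scl S0 xstar_mem) addrAC.
    exact: eproj_nonexpansive.
  have := ler_pM (enorm_ge0 _) (enorm_ge0 _) h h; rewrite -!expr2.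
  move/le_trans; apply; rewrite (enorm_sqrB (x t w - xstar)) dotrZr enormZ exprMn (gtr0_norm e0).
  by rewrite (dotrC (x t w - xstar)) le_eqVlt; apply/orP; left; apply/eqP; ring.
have h1 := ler_wpM2l (sqr_ge0 (eta t)) (aggregate_moment_le sgd est (delay_indep del) t).
have e20 : 0 <= 2 * eta t by rewrite mulr_ge0 ?ltW.
have h2 := ler_wpM2l e20 (gap_at_le t); rewrite /step_const.
move: h1 h2; move: (mean P _) (mean P _) (mean P _) (mean P _) (gap_at t) => mA mAd m1 m0 gp.
move: (n%:R : R) => N; lra.
Qed.

(** The average up to T + 1 is a convex combination of the average up to T and the new iterate, with
    weight A/B on the former. Membership is proved along with the inequality because convexity of
    [f] is available only on [S]. *)
Lemma weighted_average_jensen T w : S (weighted_average eta x T w) /\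
  (\sum_(0 <= t < T.+1) eta t) * f (weighted_average eta x T w) <=
  \sum_(0 <= t < T.+1) eta t * f (x t w).
Proof.
have e0 t := stepsize_gt0 sgd t.
have A0 T' : 0 < \sum_(0 <= t < T'.+1) eta t.
  rewrite big_nat_recr//= ltr_wpDl// sumr_ge0// => t _; exact: ltW.
elim: T => [|T [IS IH]].
  rewrite /weighted_average !big_nat1 divff ?gt_eqF// scale1r.
  by split=> //; exact: iterate_mem sgd 0 w.
have Sx := iterate_mem sgd T.+1 w.
pose A := \sum_(0 <= t < T.+1) eta t; pose B := \sum_(0 <= t < T.+2) eta t.
have BE : B = A + eta T.+1 by rewrite /B big_nat_recr.
have A_gt0 : 0 < A := A0 T.
have B_gt0 : 0 < B := A0 T.+1.
have aB : (A / B) * B = A by rewrite divfK ?gt_eqF.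
have a0 : 0 <= A / B by rewrite divr_ge0// ltW.
have a1 : A / B <= 1 by rewrite ler_pdivrMr// mul1r BE lerDl ltW.
have -> : weighted_average eta x T.+1 w =
    (A / B) *: weighted_average eta x T w + (1 - A / B) *: x T.+1 w.
  rewrite /weighted_average -/A -/B big_nat_recr//=; congr (_ + _ *: _).
    rewrite scaler_sumr; apply: eq_bigr => t _; rewrite scalerA; congr (_ *: _).
    by rewrite [RHS]mulrC [RHS]mulrA divfK ?gt_eqF.
  apply: (mulIf (lt0r_neq0 B_gt0)).
  by rewrite mulrBl aB mul1r divfK ?gt_eqF// BE addrC addKr.
split; first by apply: convex_set_segment => //; rewrite a0.
have fc : f ((A / B) *: weighted_average eta x T w + (1 - A / B) *: x T.+1 w) <=
    A / B * f (weighted_average eta x T w) + (1 - A / B) * f (x T.+1 w).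
  have := fconvex (Itv01 a0 a1) (mem_set IS) (mem_set Sx); exact.
rewrite -/B big_nat_recr//=.
apply: le_trans (ler_wpM2l (ltW B_gt0) fc) _.
have Ba : B * (A / B) = A by rewrite mulrC.
have Bb : B * (1 - A / B) = eta T.+1 by rewrite mulrBr mulr1 Ba BE addrAC subrr add0r.
by rewrite mulrDr (mulrA B (A / B)) (mulrA B (1 - _)) Ba Bb lerD2r.
Qed.

Let weights_gt0 T : 0 < \sum_(0 <= t < T.+1) eta t.
Proof.
rewrite big_nat_recr//= ltr_wpDl ?(stepsize_gt0 sgd)// sumr_ge0// => t _.
exact: ltW (stepsize_gt0 sgd t).
Qed.

Let average_le T w : f (weighted_average eta x T w) <=
  (\sum_(0 <= t < T.+1) eta t)^-1 * \sum_(0 <= t < T.+1) eta t * f (x t w).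
Proof.
have [_] := weighted_average_jensen T w.
by rewrite mulrC -ler_pdivlMr// mulrC.
Qed.

Let average_bound_rintegrable T : rintegrable P (fun w =>
  (\sum_(0 <= t < T.+1) eta t)^-1 * \sum_(0 <= t < T.+1) eta t * f (x t w)).
Proof.
apply: rintegrableZ; apply: rintegrable_sum => t; apply: rintegrableZ.
exact: objective_rintegrable.
Qed.

(** The value lies between the constant f(xstar) and the integrable weighted mean of the f(x(t)).
    This is what gives the [fine] in [expected_gap] its meaning. *)
Lemma average_objective_rintegrable T :
  rintegrable P (fun w => f (weighted_average eta x T w)).
Proof.
have iU := average_bound_rintegrable T.
apply: rintegrable_le (rintegrableD (rintegrable_cst P `|f xstar|) (integrable_norm iU)) _.
  apply: objective_measurable; last by move=> w; have [] := weighted_average_jensen T w.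
  apply: rv_measurable_sum => t; apply: rv_measurableZ.
  exact: iterate_rv_measurable sgd t.
move=> w; have h1 := average_le T w.
have h2 : f xstar <= f (weighted_average eta x T w).
  by apply: xstar_min.2; have [] := weighted_average_jensen T w.
rewrite /=; move: h1 h2; move: (f (weighted_average _ _ _ _)) (f xstar) (_ * _).
move=> a b c ac ba; rewrite ler_norml; apply/andP; split.
  by have := ler_norm (- b); rewrite normrN; have := normr_ge0 c; lra.
by have := ler_norm c; have := normr_ge0 b; lra.
Qed.

Lemma fstarE : fstar S fi = f xstar.
Proof.
apply/eqP; rewrite eq_le; apply/andP; split.
  apply: ge_inf; first exact: objective_lbound obj.
  by exists xstar.
apply: lb_le_inf; first by exists (f xstar), xstar.
by move=> _ [y Sy <-]; exact: xstar_min.2.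
Qed.

Lemma expected_gapE T : expected_gap P S fi eta x T =
  mean P (fun w => f (weighted_average eta x T w)) - f xstar.
Proof. by rewrite /expected_gap fstarE unlock. Qed.

Lemma expected_gap_ge0 T : 0 <= expected_gap P S fi eta x T.
Proof.
rewrite expected_gapE subr_ge0 -[leLHS](mean_cst P); apply: mean_le.
- exact: rintegrable_cst.
- exact: average_objective_rintegrable.
- by move=> w; apply: xstar_min.2; have [] := weighted_average_jensen T w.
Qed.

Lemma sum_gap_at_le T : 2 * (\sum_(0 <= t < T.+1) eta t * gap_at t) <=
  Rb + \sum_(0 <= t < T.+1)
    (step_const * eta t ^+ 2 + n%:R * (1 + Rb) * (eta t * q t)).
Proof.
pose D t := mean P (fun w => enorm (x t w - xstar) ^+ 2).
apply: (@le_trans _ _ (D 0%N - D T.+1 + \sum_(0 <= t < T.+1)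
    (step_const * eta t ^+ 2 + n%:R * (1 + Rb) * (eta t * q t)))); last first.
  rewrite lerD2r; apply: le_trans (iterate_dist_le sgd dist_bound 0%N).
  by rewrite gerBl; apply: mean_ge0 => w; exact: sqr_ge0.
have -> : D 0%N - D T.+1 = \sum_(0 <= t < T.+1) (D t - D t.+1).
  by rewrite -[RHS]opprK -sumrN; under eq_bigr do rewrite opprB;
    rewrite telescope_sumr// opprB.
rewrite mulr_sumr -big_split/=; apply: ler_sum => t _.
by rewrite mulrA; exact: descent.
Qed.

Lemma expected_gap_le T :
  expected_gap P S fi eta x T * (\sum_(0 <= t < T.+1) eta t) <=
  (Rb + \sum_(0 <= t < T.+1)
    (step_const * eta t ^+ 2 + n%:R * (1 + Rb) * (eta t * q t))) / 2.
Proof.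
rewrite ler_pdivlMr// mulrC; apply: le_trans (sum_gap_at_le T); rewrite ler_pM2l//.
have iU := average_bound_rintegrable T.
have h := mean_le (average_objective_rintegrable T) iU (average_le T).
rewrite expected_gapE mulrBl; apply: le_trans (lerB (ler_wpM2r (ltW (weights_gt0 T)) h) (lexx _)) _.
have iex t := rintegrableZ (eta t) (objective_rintegrable t).
rewrite meanZ; last exact: rintegrable_sum.
rewrite mulrAC mulVf ?gt_eqF// mul1r mean_sum// mulr_sumr -sumrB ler_sum// => t _.
by rewrite /gap_at mulrBr (meanZ _ (objective_rintegrable t)) (mulrC (f xstar)).
Qed.

End Descent.

(** * Rates *)

Section Rates.
Context {R : realType}.
Implicit Types (eta q gap : nat -> R).

Lemma eventually_le_eqO (f h : nat -> R) (k : R) (N : nat) : 0 < k ->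
  (forall T, (N <= T)%N -> `|f T| <= k * `|h T|) ->
  (f : nat -> R^o) =O_\oo (h : nat -> R^o).
Proof.
move=> k0 fh; apply/eqO_exP; exists k => //.
by exists N => // T /= NT; exact: fh.
Qed.

(** [s] and [c] come without a sign, hence the absolute values; the added 1 makes the constant
    positive, as a witness for the big-O must be. *)
Lemma averaged_gap_le eta q gap (B s c : R) :
  (forall t, 0 < eta t) -> (forall t, 0 <= q t) -> 0 <= B ->
  (forall T, gap T * (\sum_(0 <= t < T.+1) eta t) <=
    (B + \sum_(0 <= t < T.+1) (s * eta t ^+ 2 + c * (eta t * q t))) / 2) ->
  forall T, gap T <= (B / eta 0%N ^+ 2 + `|s| + `|c| + 1) *
    ((\sum_(0 <= t < T.+1) (eta t ^+ 2 + eta t * q t)) / \sum_(0 <= t < T.+1) eta t).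
Proof.
move=> e0 q0 B0 h T.
have A0 : 0 < \sum_(0 <= t < T.+1) eta t.
  by rewrite big_nat_recr//= ltr_wpDl// sumr_ge0// => t _; exact: ltW.
rewrite mulrA ler_pdivlMr//; apply: le_trans (h T) _.
set Q := \sum_(0 <= t < T.+1) (eta t ^+ 2 + eta t * q t).
have eq0 t : 0 <= eta t * q t by rewrite mulr_ge0// ltW.
have Q0 : eta 0%N ^+ 2 <= Q.
  rewrite /Q big_nat_recl//= -addrA lerDl addr_ge0// sumr_ge0// => t _.
  by rewrite addr_ge0 ?sqr_ge0.
(* The term at t = 0 keeps [Q] above eta(0)^2 for every [T], which absorbs the initial distance. *)
have BQ : B <= B / eta 0%N ^+ 2 * Q.
  rewrite mulrAC ler_pdivlMr ?exprn_gt0//; exact: ler_wpM2l.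
have sQ : \sum_(0 <= t < T.+1) (s * eta t ^+ 2 + c * (eta t * q t)) <= (`|s| + `|c|) * Q.
  rewrite /Q mulr_sumr; apply: ler_sum => t _.
  have := ler_wpM2r (sqr_ge0 (eta t)) (ler_norm s); have := ler_wpM2r (eq0 t) (ler_norm c).
  have := mulr_ge0 (normr_ge0 s) (eq0 t); have := mulr_ge0 (normr_ge0 c) (sqr_ge0 (eta t)).
  by move: (eta t * q t) (eta t ^+ 2) => a b; lra.
have Q00 := le_trans (sqr_ge0 _) Q0.
have BQ0 := mulr_ge0 (divr_ge0 B0 (sqr_ge0 (eta 0%N))) Q00.
have sQ0 := mulr_ge0 (addr_ge0 (normr_ge0 s) (normr_ge0 c)) Q00.
clear Q0; move: BQ sQ BQ0 sQ0 Q00; move: (\sum_(0 <= t < _) _) Q (B / _) => a b e; lra.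
Qed.

Lemma ln_ge_sub_inv (y : R) : 0 < y -> 1 - y^-1 <= ln y.
Proof.
move=> y0; have y1 : -1 < y^-1 - 1 by rewrite ltrBrDl subrr invr_gt0.
have := le_ln1Dx y1; rewrite addrCA subrr addr0 lnV ?posrE//; lra.
Qed.

Lemma harmonic_le T : \sum_(0 <= t < T.+1) (t.+1%:R : R)^-1 <= 1 + ln T.+1%:R.
Proof.
elim: T => [|T IH]; first by rewrite big_nat1 invr1 ln1 addr0.
rewrite big_nat_recr//=; apply: le_trans (lerD IH (lexx _)) _.
rewrite -addrA lerD2l.
have pos k : (0 : R) < k.+1%:R by rewrite ltr0n.
(* At this ratio 1 - 1/y equals 1/(T+2), so the new term is at most the increment of the
   logarithm. *)
have := @ln_ge_sub_inv (T.+2%:R / T.+1%:R) (divr_gt0 (pos _) (pos _)).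
rewrite ln_div ?posrE// invf_div => h.
suff : (T.+2%:R : R)^-1 = 1 - T.+1%:R / T.+2%:R by move=> ->; rewrite addrC -lerBrDr.
rewrite -[X in X - _](divff (lt0r_neq0 (pos T.+1))) -mulrBl -natrB//.
by rewrite subSnn mul1r.
Qed.

Lemma ln_ge_half T : (2 <= T)%N -> 1 / 2 <= ln (T%:R : R).
Proof.
move=> T2; apply: le_trans (ln_ge_sub_inv _); last by rewrite ltr0n (leq_trans _ T2).
have : (T%:R : R)^-1 <= 2^-1 by rewrite lef_pV2 ?posrE ?ltr0n ?ler_nat// (leq_trans _ T2).
by lra.
Qed.

(** For T >= 2 one has 1 <= 2 ln T, and T + 1 <= T^2 gives ln (T + 1) <= 2 ln T. At T = 1 the right
    side vanishes. *)
Lemma harmonic_le_ln T : (2 <= T)%N ->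
  \sum_(0 <= t < T.+1) (t.+1%:R : R)^-1 <= 4 * ln T%:R.
Proof.
move=> T2; apply: le_trans (harmonic_le T) _.
have Tp : (0 : R) < T%:R by rewrite ltr0n (leq_trans _ T2).
have h : ln (T.+1%:R : R) <= 2 * ln T%:R.
  rewrite mulr_natl -lnXn// ler_ln ?posrE ?ltr0n ?exprn_gt0// -natrX ler_nat.
  by rewrite -addn1 -mulnn (leq_trans _ (leq_mul T2 (leqnn T)))// mul2n -addnn leq_add2l (leq_trans _ T2).
by have := ln_ge_half T2; lra.
Qed.

Lemma stepsize_sum_ge (eta0 : R) eta T : 0 < eta0 ->
  (forall t, eta t = eta0 / Num.sqrt t.+1%:R) ->
  eta0 * Num.sqrt T%:R <= \sum_(0 <= t < T.+1) eta t.
Proof.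
move=> e0 etaE.
have s0 t : (0 : R) < Num.sqrt t.+1%:R by rewrite sqrtr_gt0 ltr0n.
apply: (@le_trans _ _ (\sum_(0 <= t < T.+1) (eta0 / Num.sqrt T.+1%:R))).
  rewrite sumr_const_nat subn0 -[leRHS]mulr_natr -mulrA ler_pM2l//.
  rewrite -{2}[T.+1%:R]sqr_sqrtr ?ler0n// expr2 mulrA mulVf ?gt_eqF// mul1r.
  by rewrite ler_sqrt ?ltr0n// ler_nat.
apply: ler_sum_nat => t /andP[_ tT]; rewrite etaE ler_pM2l// lef_pV2 ?posrE//.
by rewrite ler_sqrt ?ltr0n// ler_nat.
Qed.

Lemma stepsize_bias_sum_le (eta0 q0 beta : R) eta q T : (2 <= T)%N -> 0 < eta0 -> 0 < q0 ->
  1 / 2 <= beta ->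
  (forall t, eta t = eta0 / Num.sqrt t.+1%:R) -> (forall t, q t = q0 / t.+1%:R `^ beta) ->
  \sum_(0 <= t < T.+1) (eta t ^+ 2 + eta t * q t) <=
  (eta0 ^+ 2 + eta0 * q0) * (4 * ln T%:R).
Proof.
move=> T2 e0 q00 b2 etaE qE.
have c0 : 0 <= eta0 ^+ 2 + eta0 * q0 by rewrite addr_ge0 ?sqr_ge0 ?mulr_ge0 ?ltW.
apply: le_trans (ler_wpM2l c0 (harmonic_le_ln T2)); rewrite mulr_sumr.
apply: ler_sum => t _.
have s0 : (0 : R) < Num.sqrt t.+1%:R by rewrite sqrtr_gt0 ltr0n.
have sE : (Num.sqrt t.+1%:R : R) ^+ 2 = t.+1%:R by rewrite sqr_sqrtr ?ler0n.
(* This is where beta >= 1/2 enters: it makes eta(t) q(t) of order 1/(t+1), like eta(t)^2. *)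
have sb : Num.sqrt t.+1%:R <= t.+1%:R `^ beta :> R.
  rewrite -powR12_sqrt ?ler0n// ler_powR//; first by rewrite ler1n.
  by move: b2; rewrite mul1r.
rewrite etaE qE mulrDl expr_div_n sE lerD2l mulf_div ler_pM2l ?mulr_gt0//.
rewrite lef_pV2 ?posrE ?mulr_gt0 ?ltr0n ?powR_gt0//.
by rewrite -[X in X <= _]sE expr2 ler_pM2l.
Qed.

(** From ln y < y at y = T^eps, that is, eps ln T < T^eps. *)
Lemma ln_sqrt_le (eps : R) (T : nat) : 0 < eps -> (0 < T)%N ->
  ln T%:R / Num.sqrt T%:R <= eps^-1 * (1 / T%:R `^ (1 / 2 - eps)) :> R.
Proof.
move=> e0 T1; have Tp : (0 : R) < T%:R by rewrite ltr0n.
have -> : Num.sqrt (T%:R : R) = T%:R `^ (1 / 2 - eps) * T%:R `^ eps.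
  rewrite -powRD ?subrK ?mul1r ?powR12_sqrt ?ltW//.
  by apply/implyP => _; rewrite gt_eqF.
rewrite (_ : ln _ / _ = (T%:R `^ (1 / 2 - eps))^-1 * (ln T%:R / T%:R `^ eps)); last first.
  by rewrite invfM mulrCA.
rewrite [leRHS]mulrC [1 / (_ `^ _)]mul1r ler_pM2l ?invr_gt0 ?powR_gt0//.
rewrite ler_pdivrMr ?powR_gt0// [leRHS]mulrC ler_pdivlMr// mulrC -ln_powR.
exact: ltW (ln_sublinear (powR_gt0 _ Tp)).
Qed.

Lemma ln_sqrt_eqO (eps : R) : 0 < eps ->
  (fun T : nat => ln T%:R / Num.sqrt T%:R : R^o) =O_\oo
  (fun T : nat => 1 / T%:R `^ (1 / 2 - eps) : R^o).
Proof.
move=> e0; apply: (@eventually_le_eqO _ _ eps^-1 1); first by rewrite invr_gt0.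
move=> T T1; rewrite !ger0_norm ?divr_ge0 ?powR_ge0 ?sqrtr_ge0 ?ln_ge0 ?ler1n//.
exact: ln_sqrt_le.
Qed.

Lemma stepsize_ratio_bounded eta (kappa etabar : R) : 0 <= kappa -> (forall t, 0 < eta t) ->
  nonincreasing_seq eta ->
  eta (nat_ceil (kappa * t%:R)) / eta t @[t --> \oo] --> etabar ->
  exists M, forall t s : nat, kappa * t%:R <= s%:R -> eta s <= M * eta t.
Proof.
move=> kappa0 e0 ni cv.
have cvn : cvgn (fun t => eta (nat_ceil (kappa * t%:R)) / eta t : R^o).
  by apply/cvg_ex; exists etabar.
have [M [_ hM]] := cvg_seq_bounded cvn.
(* Boundedness provides the bound for every number strictly above [M]. Monotonicity then passes from
   the ceiling of kappa t to any later [s]. *)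
exists (M + 1) => t s ts.
have hc : (nat_ceil (kappa * t%:R) <= s)%N.
  rewrite /nat_ceil -lez_nat gez0_abs ?ceil_le_int// ceil_ge0.
  by apply: lt_le_trans (mulr_ge0 kappa0 (ler0n _ _)); rewrite ltrN10.
apply: le_trans (ni _ _ hc) _; rewrite -ler_pdivrMr//.
apply: le_trans (ler_norm _) _; apply: (hM (M + 1)) => //; by rewrite ltrDl.
Qed.

End Rates.

Theorem theorem10 (R : realType) (d n : nat)
    (disp : measure_display) (Omega : measurableType disp)
    (P : probability Omega R)
    (dispX : measure_display) (Xi : measurableType dispX)
    (S : set 'rV[R]_d)
    (fi : 'I_n -> 'rV[R]_d -> R) (gfi : 'I_n -> 'rV[R]_d -> 'rV[R]_d)
    (x0 : 'rV[R]_d) (eta : nat -> R)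
    (g : 'I_n -> 'rV[R]_d -> Xi -> 'rV[R]_d) (xi : nat -> Omega -> Xi)
    (tau : 'I_n -> nat -> Omega -> int) (x : nat -> Omega -> 'rV[R]_d)
    (gtilde : 'I_n -> nat -> Omega -> 'rV[R]_d)
    (L G C kappa : R) (q : nat -> R) (xstar : 'rV[R]_d) (Rb : R) :
  delayed_projected_sgd P S x0 eta g xi tau x ->
  objective_assumption S fi gfi L ->
  estimator_assumption P gfi g xi x gtilde L G q ->
  delay_assumption P tau C kappa ->
  @convex_function R 'rV[R]_d S (objective fi) ->
  argmin_on S (objective fi) xstar ->
  0 < Rb ->
  (forall t, ('E_P[fun w => (enorm (x t w - xstar) ^+ 2)%R] <= Rb%:E)%E) ->
  let gap := expected_gap P S fi eta x : nat -> R^o in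
  (forall T, P.-integrable setT
     (EFin \o (objective fi \o weighted_average eta x T)))
  /\
  (forall etabar : R,
     nonincreasing_seq eta ->
     0 < etabar ->
     eta (nat_ceil (kappa * t%:R)) / eta t @[t --> \oo] --> etabar ->
     (\sum_(0 <= t <oo) (eta t)%:E = +oo)%E ->
     gap =O_\oo (fun T : nat =>
       (\sum_(0 <= t < T.+1) (eta t ^+ 2 + eta t * q t))
       / \sum_(0 <= t < T.+1) eta t : R^o))
  /\
  (forall eta0 q0 beta : R,
     0 < eta0 -> 0 < q0 -> 1 / 2 <= beta ->
     (forall t, eta t = eta0 / Num.sqrt t.+1%:R) ->
     (forall t, q t = q0 / t.+1%:R `^ beta) ->
     let rate := (fun T : nat => ln T%:R / Num.sqrt T%:R) : nat -> R^o in
     gap =O_\oo rate /\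
     forall eps : R, 0 < eps -> eps < 1 / 2 ->
       let rate_eps := (fun T : nat => 1 / T%:R `^ (1 / 2 - eps)) : nat -> R^o in
       rate =O_\oo rate_eps /\ gap =O_\oo rate_eps).
Proof.
move=> sgd obj est del fconvex xmin Rb0 bound gap.
have e0 := stepsize_gt0 sgd.
have q0 := bias_ge0 est.
have /andP[kappa0 kappa1] := kappa_itv del.
have gap0 T : 0 <= gap T := expected_gap_ge0 sgd obj fconvex xmin bound T.
have gap_le M (hM : forall t s : nat, kappa * t%:R <= s%:R -> eta s <= M * eta t) T :=
  averaged_gap_le e0 q0 (ltW Rb0)
    (expected_gap_le sgd obj est del fconvex xmin Rb0 bound hM) T.
have gapO (M : R) : (forall t s : nat, kappa * t%:R <= s%:R -> eta s <= M * eta t) ->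
    exists2 k, 0 < k & forall T, gap T <= k *
      ((\sum_(0 <= t < T.+1) (eta t ^+ 2 + eta t * q t)) / \sum_(0 <= t < T.+1) eta t).
  move=> hM; eexists; last exact: gap_le hM.
  by rewrite ltr_wpDl// !addr_ge0// divr_ge0 ?sqr_ge0// ltW.
split; first exact: average_objective_rintegrable sgd obj fconvex xmin bound.
split.
  move=> etabar ni etabar0 cv _.
  have [M /gapO[k k0 hk]] := stepsize_ratio_bounded (ltW kappa0) e0 ni cv.
  apply: (@eventually_le_eqO _ _ _ k 0) => // T _.
  rewrite ger0_norm//; apply: le_trans (hk T) _.
  by rewrite ler_wpM2l ?ler_norm// ltW.
move=> eta0 q00 beta eta00 q000 beta2 etaE qE rate.
have sqrt0 t : (0 : R) < Num.sqrt t.+1%:R by rewrite sqrtr_gt0 ltr0n.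
(* For the explicit step sizes the ratio bound is direct: s >= kappa t and kappa < 1 give s + 1 >=
   kappa (t + 1), whence the constant 1 / sqrt kappa. *)
have /gapO[k k0 hk] (t s : nat) : kappa * t%:R <= s%:R ->
    eta s <= (Num.sqrt kappa)^-1 * eta t.
  move=> ts; rewrite !etaE mulrCA ler_pM2l// -invfM lef_pV2 ?posrE ?mulr_gt0 ?sqrtr_gt0//.
  rewrite -sqrtrM ?(ltW kappa0)// ler_sqrt ?ler0n// -!natr1 mulrDr mulr1 lerD//.
  exact: ltW.
have gap_rate : gap =O_\oo rate.
  (* The constant is read off from the numerator bound of [stepsize_bias_sum_le], valid from T = 2
     on, divided by the lower bound of [stepsize_sum_ge]. *)
  apply: (@eventually_le_eqO _ _ _ (k * ((eta0 ^+ 2 + eta0 * q00) * 4 / eta0)) 2).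
    by rewrite mulr_gt0// divr_gt0// mulr_gt0// addr_gt0 ?exprn_gt0 ?mulr_gt0.
  move=> T T2; have Tp : (0 : R) < T%:R by rewrite ltr0n (leq_trans _ T2).
  have l0 : 0 <= ln (T%:R : R) by rewrite ln_ge0// ler1n (leq_trans _ T2).
  rewrite !ger0_norm ?divr_ge0 ?sqrtr_ge0//.
  suff : gap T <= k * ((eta0 ^+ 2 + eta0 * q00) * 4 / eta0) *
    (ln T%:R / Num.sqrt T%:R) :> R by [].
  apply: le_trans (hk T) _; rewrite -mulrA ler_pM2l//.
  have h1 := stepsize_bias_sum_le T2 eta00 q000 beta2 etaE qE.
  have h2 := stepsize_sum_ge T eta00 etaE.
  have es0 : 0 < eta0 * Num.sqrt T%:R by rewrite mulr_gt0 ?sqrtr_gt0.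
  rewrite ler_pdivrMr ?(lt_le_trans es0)//; apply: le_trans h1 _.
  rewrite [X in _ <= X * _](_ : _ = (eta0 ^+ 2 + eta0 * q00) * (4 * ln T%:R) /
      (eta0 * Num.sqrt T%:R)); last by rewrite invfM; ring.
  rewrite mulrAC ler_pdivlMr// ler_wpM2l// !mulr_ge0// ltW//.
  by rewrite addr_gt0 ?exprn_gt0 ?mulr_gt0.
split=> // eps eps0 eps1 rate_eps.
have rateO : rate =O_\oo rate_eps := ln_sqrt_eqO eps0.
by split=> //; exact: eqO_trans gap_rate rateO.
Qed.
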